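(* Let $\Omega\subset\mathbb{R}^d$ be a bounded domain centered at the origin and let $\omega=\mathbb{R}^d\setminus\overline{\Omega}$. Assume the Hamiltonian flow is non-zero on the interval $[0,T_D]$. Then for all $T\in(0,T_D)$ with $T<\infty$ there exists a nonzero constant $C_T$, depending on $\Omega$, the $L^\infty([0,T])$ norm of $\kappa_2$ and the $C^1([0,T])$ norm of $\kappa_1$, such that the solution $u$ of $$\partial_tu+i\left(-\kappa_1(t)\Delta+\kappa_2(t)|x|^2\right)u=0,\quad 0<t\le T,\ x\in\mathbb{R}^d,\qquad u(0,x)=u_0(x),$$ with initial data $u_0\in\mathcal{A}$ (with associated $N,\eta,\tilde a_n,\tilde c_n$) satisfies $$\|u_0\|_{L^2(\mathbb{R}^d)}-\eta\le C_T\left(\|u\|_{L^2((0,T)\times\omega)}+T\eta\right)$$ provided $\tilde a_n=\varepsilon n$ with $\varepsilon>0$ sufficiently small, in the sense that for the given $N$ and all $t\in[0,T]$ $$\varepsilon N\left[\frac{\sqrt{1+16y_3(t)^2}}{2|y_2(t)|}e^{\frac{2|y_2(t)|^2R_0^2+2|y_2(t)|NR_0}{1+16y_3(t)^2}}+\sqrt{2\pi}\,\frac{N+1}{|y_2(t)|}\,e^{\frac{2N^2}{1+16y_3(t)^2}}\right]\le\frac12\int_{R_0}^\infty e^{-A(t)r^2}\,dr,$$ where $A(t)=\frac{2|y_2(t)|^2}{1+16y_3(t)^2}$ and $R_0>1$ is a radius with $\Omega\subset B_{R_0}$, the ball of radius $R_0$ about the origin.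
   Context: Standing assumptions: $\kappa_1\in C^1$ is bounded below by a positive constant, $\kappa_2$ is continuous and $\kappa_2\ge0$. The Hamiltonian trajectory is the solution of $x_i'=2\kappa_1(t)p_i$, $p_i'=-2\kappa_2(t)x_i$ ($i=1,\dots,d$), $x(0)=(1,\dots,1)$, $p(0)=0$; the Hamiltonian flow is non-zero on an interval if $x_i(t)\neq0$ for all $i$ and all $t$ in it and $a(t)=\exp\big(-\int_0^t\frac{p_i(s)\kappa_1(s)}{x_i(s)}ds\big)$ is bounded on it. The functions $y_1,y_2,y_3$ solve $y_1'=-4\kappa_1y_1^2-\kappa_2$, $y_1(0)=0$; $y_2'=-4\kappa_1y_1y_2$, $y_2(0)=1$; $y_3'=-\kappa_1y_2^2$, $y_3(0)=0$. A bounded domain is centered at the origin if the (enclosing) ball containing it has its center at the origin. Let $B=\{u\in L^2(\mathbb{R}^d):x^\alpha D_x^\beta u\in L^2,\ |\alpha+\beta|\le2\}$ with $\|u\|_B^2=\sum_{|\alpha+\beta|=2}\|x^\alpha D_x^\beta u\|_{L^2}^2$. A $B$-valued solution is $u\in C^0([0,T],B)\cap C^1([0,T],L^2(\mathbb{R}^d))$ satisfying the equation in $L^2$; for each $u_0\in B$ a unique $B$-valued solution exists and propagation is unitary on $L^2$. The class $\mathcal{A}$ consists of $f\in L^2(\mathbb{R}^d)$ with bounded $B$ norm for which there exist a natural number $N>2$, $\eta\in(0,1)$, $\tilde a_n\in\mathbb{R}^d$ and $\tilde c_n\in\mathbb{R}_+$, indexed by $n=(n_1,\dots,n_d)$ with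 $n_i\in\{0,\dots,N\}$, $|n|=n_1+\dots+n_d\le N$, such that $\big(\int_{\mathbb{R}^d}|f(x)-\sum_{|n|\le N}\tilde c_ne^{-|x+\tilde a_n|^2}|^2dx\big)^{1/2}\le\eta$. *)

(* Defs.v *)
From HB Require Import structures.
From mathcomp Require Import all_boot all_order all_algebra.
From mathcomp Require Import all_classical all_reals all_analysis.
From mathcomp.real_closed Require Import complex.
Set Implicit Arguments.
Unset Strict Implicit.
Unset Printing Implicit Defensive.
Import Order.TTheory GRing.Theory Num.Theory.
Import numFieldNormedType.Exports.
Local Open Scope classical_set_scope.
Local Open Scope ring_scope.

Fact rV_display : measure_display. Proof. exact: default_measure_display. Qed.

(* Product (equivalently, Borel) sigma-algebra on R^n, as for n.-tuple. *)
Section measurable_rV.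
Context {R : realType} (n : nat).

Definition rV_coord (i : 'I_n) (x : 'rV[R]_n) : R := x ord0 i.

Let rV_set0 : g_sigma_preimage rV_coord set0.
Proof. exact: sigma_algebra0. Qed.

Let rV_setC A : g_sigma_preimage rV_coord A -> g_sigma_preimage rV_coord (~` A).
Proof. exact: sigma_algebraC. Qed.

Let rV_bigcup (F : (set 'rV[R]_n)^nat) :
  (forall i, g_sigma_preimage rV_coord (F i)) ->
  g_sigma_preimage rV_coord (\bigcup_i F i).
Proof. exact: sigma_algebra_bigcup. Qed.

HB.instance Definition _ := @isMeasurable.Build rV_display
  'rV[R]_n (g_sigma_preimage rV_coord) rV_set0 rV_setC rV_bigcup.

Lemma measurable_rV_coord (i : 'I_n) : measurable_fun [set: 'rV[R]_n] (rV_coord i).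
Proof.
move=> _ Y mY; rewrite setTI; apply: sub_sigma_algebra => /=.
rewrite -bigcup_seq/=; exists i => /=; first by rewrite mem_index_enum.
by exists Y => //; rewrite setTI.
Qed.

Lemma measurable_fun_rV d (T : measurableType d) (f : T -> 'rV[R]_n) :
  (forall i, measurable_fun setT (rV_coord i \o f)) -> measurable_fun setT f.
Proof.
move=> mf; apply: (@measurability _ _ _ _ _ _
  (\big[setU/set0]_(i < n) preimage_set_system setT (rV_coord i) measurable)) => //.
move=> _ [B + <-]; rewrite setTI -bigcup_seq => -[i _ [A mA <-]].
by rewrite setTI -[X in measurable X]setTI; exact: (mf i).
Qed.

End measurable_rV.

Lemma sigma_finite_product d1 d2 (T1 : measurableType d1)
    (T2 : measurableType d2) (R : realType)
    (m1 : {sigma_finite_measure set T1 -> \bar R})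
    (m2 : {sigma_finite_measure set T2 -> \bar R}) :
  sigma_finite setT (m1 \x m2)%E.
Proof.
have /sigma_finiteP[F [TF ndF Foo]] := sigma_finiteT m1.
have /sigma_finiteP[G [TG ndG Goo]] := sigma_finiteT m2.
exists (fun n => F n `*` G n).
  rewrite -setXTT TF TG predeqE => -[x y]; split.
    move=> [/= [n _ Fnx] [k _ Gky]]; exists (maxn n k) => //; split.
    - by move: x Fnx; exact/subsetPset/ndF/leq_maxl.
    - by move: y Gky; exact/subsetPset/ndG/leq_maxr.
  by move=> [n _ []/= ? ?]; split; exists n.
move=> k; have [? ?] := Foo k; have [? ?] := Goo k.
split; first exact: measurableX.
by rewrite product_measure1E// lte_mul_pinfty// ge0_fin_numE.
Qed.

Section rV_cons.
Context {R : realType} (n : nat).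

Definition rV_cons (p : R * 'rV[R]_n) : 'rV[R]_n.+1 :=
  row_mx (const_mx p.1 : 'rV_1) p.2.

Definition rV_uncons (x : 'rV[R]_n.+1) : R * 'rV[R]_n :=
  (x ord0 ord0, rsubmx (x : 'rV_(1 + n))).

Lemma rV_consK : cancel rV_cons rV_uncons.
Proof.
move=> [a v]; rewrite /rV_uncons /rV_cons; congr (_, _); last by rewrite row_mxKr.
have -> : ord0 = lshift n (ord0 : 'I_1) by apply: val_inj.
by rewrite (row_mxEl (const_mx a : 'rV_1)) mxE.
Qed.

Lemma rV_unconsK : cancel rV_uncons rV_cons.
Proof.
move=> x; rewrite /rV_uncons /rV_cons /= -[RHS](@hsubmxK _ _ 1 n).
suff -> : const_mx (x ord0 ord0) = lsubmx (x : 'rV_(1 + n)) by [].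
apply/rowP => j; rewrite !mxE.
by congr (x _ _); apply: val_inj; rewrite /= ord1.
Qed.

Lemma measurable_rV_cons : measurable_fun setT rV_cons.
Proof.
apply: measurable_fun_rV => i.
have [j|j] := split_ordP (i : 'I_(1 + n)) => ij.
- rewrite (_ : _ \o _ = fst); first exact: measurable_fst.
  by apply/funext => p /=; rewrite /rV_coord ij /rV_cons (row_mxEl (const_mx p.1 : 'rV_1)) mxE.
- rewrite (_ : _ \o _ = rV_coord j \o snd).
    by apply: measurableT_comp => //; exact: measurable_rV_coord.
  by apply/funext => p /=; rewrite /rV_coord ij /rV_cons (row_mxEr (const_mx p.1 : 'rV_1)).
Qed.

Lemma measurable_rV_uncons : measurable_fun setT rV_uncons.
Proof.
apply/measurable_fun_pairP; split; first exact: (measurable_rV_coord ord0).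
apply: measurable_fun_rV => i.
rewrite (_ : _ \o _ = rV_coord (rshift 1 i : 'I_n.+1)).
  exact: measurable_rV_coord.
by apply/funext => x /=; rewrite /rV_coord mxE.
Qed.

Variable mu : {sigma_finite_measure set 'rV[R]_n -> \bar R}.

(* The product of the Lebesgue measure on R with mu, carried to R^(n+1). *)
Definition prod_rV : set 'rV[R]_n.+1 -> \bar R :=
  pushforward (@lebesgue_measure R \x mu)%E rV_cons.

Let measurable_preimage A : measurable A -> measurable (rV_cons @^-1` A).
Proof. by move=> mA; rewrite -[X in measurable X]setTI; exact: measurable_rV_cons. Qed.

Let prod_rV0 : prod_rV set0 = 0%E.
Proof. by rewrite /prod_rV /pushforward preimage_set0 measure0. Qed.

Let prod_rV_ge0 A : (0 <= prod_rV A)%E.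
Proof. by rewrite /prod_rV /pushforward measure_ge0. Qed.

Let prod_rV_sigma_additive : semi_sigma_additive prod_rV.
Proof.
move=> F mF tF mUF; rewrite /prod_rV /pushforward preimage_bigcup.
apply: measure_semi_sigma_additive.
- by move=> k; exact: measurable_preimage.
- apply/trivIsetP => /= i j _ _ ij; rewrite -preimage_setI.
  by move/trivIsetP : tF => /(_ _ _ _ _ ij) ->//; rewrite preimage_set0.
- by rewrite -preimage_bigcup; exact: measurable_preimage.
Qed.

HB.instance Definition _ := isMeasure.Build _ _ _ prod_rV
  prod_rV0 prod_rV_ge0 prod_rV_sigma_additive.

Let sigma_finite_prod_rV : sigma_finite setT prod_rV.
Proof.
have [F FT mF] := sigma_finite_product (@lebesgue_measure R) mu.
exists (fun k => rV_uncons @^-1` F k).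
  by rewrite -preimage_bigcup -FT preimage_setT.
move=> k; have [mFk Fkoo] := mF k; split.
  by rewrite -[X in measurable X]setTI; exact: measurable_rV_uncons.
rewrite /prod_rV /pushforward -comp_preimage (_ : _ \o _ = id) ?preimage_id//.
by apply/funext => p /=; rewrite rV_consK.
Qed.

HB.instance Definition _ :=
  Measure_isSigmaFinite.Build _ _ _ prod_rV sigma_finite_prod_rV.

End rV_cons.

Section lebesgue_rV.
Context {R : realType}.

Fixpoint lebesgue_rV n : {sigma_finite_measure set 'rV[R]_n -> \bar R} :=
  match n with
  | 0 => \d_ (0 : 'rV[R]_0)
  | n.+1 => prod_rV (lebesgue_rV n)
  end.

Lemma lebesgue_rV_box n (A : 'I_n -> set R) :
  (forall i, measurable (A i)) ->
  lebesgue_rV n [set x | forall i, A i (x ord0 i)] =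
  (\big[mule/1%E]_(i < n) lebesgue_measure (A i))%E.
Proof.
have mbox m (B : 'I_m -> set R) : (forall i, measurable (B i)) ->
    measurable [set x : 'rV[R]_m | forall i, B i (x ord0 i)].
  move=> mB; rewrite (_ : [set x | _] = \big[setI/setT]_(i < m)
      (rV_coord i @^-1` B i)).
    apply: bigsetI_measurable => i _.
    by rewrite -[X in measurable X]setTI; exact: measurable_rV_coord.
  rewrite -bigcap_seq; apply/seteqP; split=> [x + i _|x Bx i]; first exact.
  by apply: Bx => /=; rewrite mem_index_enum.
elim: n A => [|n IH] A mA /=.
  by rewrite big_ord0 diracE mem_set// => -[].
rewrite big_ord_recl -IH// /prod_rV /pushforward.
have mB : measurable [set x : 'rV[R]_n | forall i, A (lift ord0 i) (x ord0 i)].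
  exact: (mbox n (fun i => A (lift ord0 i)) (fun i => mA _)).
rewrite -[RHS](@product_measure1E _ _ _ _ _ (@lebesgue_measure R)
  (lebesgue_rV n) _ _ (mA ord0) mB).
congr (_ _); apply/seteqP; split=> -[r v] /=.
- move=> Arv; split=> [|i].
    by have := Arv ord0; rewrite -[X in X -> _]/(A _ ((rV_uncons (rV_cons (r, v))).1)) rV_consK.
  have := Arv (lift ord0 i).
  by rewrite /rV_cons (_ : lift ord0 i = rshift 1 i)
    ?(row_mxEr (const_mx r : 'rV_1))//; apply: val_inj.
- move=> [Ar Av] i; have [j|j] := split_ordP (i : 'I_(1 + n)) => ->.
    by rewrite /rV_cons (row_mxEl (const_mx r : 'rV_1)) mxE ord1
      (_ : lshift n ord0 = ord0)//; apply: val_inj.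
  by have := Av j; rewrite /rV_cons (_ : lift ord0 j = rshift 1 j)
    ?(row_mxEr (const_mx r : 'rV_1))//; apply: val_inj.
Qed.

End lebesgue_rV.

Section euclidean.
Context {R : realType} {d : nat}.
Implicit Types (x : 'rV[R]_d) (Omega : set 'rV[R]_d).

(* The library norm on 'rV_d is the sup norm; these are the Euclidean notions. *)
Definition sqnorm x : R := \sum_i x ord0 i ^+ 2.

Definition eball (r : R) : set 'rV[R]_d := [set x | Num.sqrt (sqnorm x) < r].

Definition bounded_domain Omega : Prop :=
  [/\ open Omega, connected Omega, Omega !=set0 & bounded_set Omega].

(* Some enclosing ball has its center at the origin. *)
Definition centered_at_origin Omega : Prop :=
  exists2 r : R, 0 < r & Omega `<=` eball r.

End euclidean.

Section L2.
Context {R : realType} {d : nat}.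
Local Notation E := 'rV[R]_d.
Local Notation mu := (@lebesgue_rV R d).
Implicit Types (f g u v : E -> R[i]).

Definition L2norm f : \bar R := Lnorm mu 2%:E (fun x => (Normc.normc (f x))%:E).

(* Elements of L2 are represented by functions, so equality in L2 is equality
   almost everywhere. *)
Definition inL2 f : Prop :=
  [/\ measurable_fun setT (fun x => complex.Re (f x)),
      measurable_fun setT (fun x => complex.Im (f x)) &
      (L2norm f < +oo)%E].

Definition cintegral f : R[i] :=
  ((\int[mu]_x complex.Re (f x)) +i* (\int[mu]_x complex.Im (f x)))%C.

Definition partial (i : 'I_d) (phi : E -> R) : E -> R :=
  fun x => 'D_(delta_mx ord0 i) phi x.

Definition smooth (phi : E -> R) : Prop := forall s : seq 'I_d,
  let psi := foldr partial phi s in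
  continuous psi /\ forall i x, derivable psi x (delta_mx ord0 i).

Definition test_function (phi : E -> R) : Prop :=
  smooth phi /\
  exists2 K : set E, compact K & forall x, ~ K x -> phi x = 0.

(* Only multi-indices of order at most 2 occur, so their entries are in
   {0, 1, 2}. *)
Definition mindex : predArgType := {ffun 'I_d -> 'I_3}.

Definition mord (b : mindex) : nat := (\sum_i b i)%N.

Definition monomial (a : mindex) (x : E) : R := \prod_i x ord0 i ^+ a i.

(* The convention D = -i d/dx would change the derivatives below only by unimodular
   constants, hence neither B nor its norm. *)
Definition mpartial (b : mindex) (phi : E -> R) : E -> R :=
  foldr (fun i => iter (b i) (partial i)) phi (enum 'I_d).

Definition weak_derivative (b : mindex) u v : Prop :=
  inL2 v /\ forall phi, test_function phi ->
    cintegral (fun x => u x * (mpartial b phi x)%:C%C) =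
    (-1) ^+ mord b * cintegral (fun x => v x * (phi x)%:C%C).

(* A representative of the weak derivative, which is unique almost everywhere;
   0 if there is none in L2. *)
Definition wD (b : mindex) u : E -> R[i] :=
  xget (fun=> 0) [set v | weak_derivative b u v].

(* The multi-index 2 e_i. *)
Definition dbl (i : 'I_d) : mindex :=
  [ffun j => if j == i then ord_max else ord0].

Definition laplacian u : E -> R[i] := fun x => \sum_i wD (dbl i) u x.

Definition weighted (a b : mindex) u : E -> R[i] :=
  fun x => (monomial a x)%:C%C * wD b u x.

Definition inB u : Prop :=
  inL2 u /\ forall a b : mindex, (mord a + mord b <= 2)%N ->
    (exists v, weak_derivative b u v) /\
    inL2 (weighted a b u).

(* Only the terms of order exactly 2 enter the norm. *)
Definition Bnorm u : \bar R :=
  ((\sum_(ab : mindex * mindex | (mord ab.1 + mord ab.2 == 2)%N)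
      L2norm (weighted ab.1 ab.2 u) ^+ 2)
     `^ 2^-1)%E.

End L2.
Arguments mindex d : clear implicits.

Section odes.
Context {R : realType}.
Implicit Types (I : set R) (f g : R -> R).

(* Differentiability relative to I, hence one-sided at endpoints lying in I. *)
Definition deriv_on I f g : Prop := forall t, I t ->
  (s - t)^-1 * (f s - f t) @[s --> within I t^'] --> g t.

(* dk1 is the derivative of k1; times are nonnegative. *)
Definition coefficients (k1 dk1 k2 : R -> R) : Prop :=
  [/\ deriv_on `[0, +oo[ k1 dk1,
      {within `[0, +oo[, continuous dk1},
      (exists2 c : R, 0 < c & forall t, 0 <= t -> c <= k1 t),
      {within `[0, +oo[, continuous k2} &
      forall t, 0 <= t -> 0 <= k2 t].

Definition supnorm (T : R) f : R := sup [set `|f t| | t in `[0, T]].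

Definition trajectory {d} I (k1 k2 : R -> R) (x p : 'I_d -> R -> R) : Prop :=
  forall i, [/\ deriv_on I (x i) (fun t => 2 * k1 t * p i t),
                deriv_on I (p i) (fun t => - 2 * k2 t * x i t),
                x i 0 = 1 & p i 0 = 0].

Definition flow_nonzero d I (k1 k2 : R -> R) : Prop :=
  exists x p : 'I_d -> R -> R,
    [/\ trajectory I k1 k2 x p,
        (forall i t, I t -> x i t != 0) &
        forall i, [bounded expR (- \int[lebesgue_measure]_(s in `[0, t])
                                      (p i s * k1 s / x i s)) : R^o | t in I]].

Definition riccati_system I (k1 k2 y1 y2 y3 : R -> R) : Prop :=
  [/\ deriv_on I y1 (fun t => - 4 * k1 t * y1 t ^+ 2 - k2 t),
      deriv_on I y2 (fun t => - 4 * k1 t * y1 t * y2 t),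
      deriv_on I y3 (fun t => - k1 t * y2 t ^+ 2) &
      [/\ y1 0 = 0, y2 0 = 1 & y3 0 = 0]].

End odes.

Section schroedinger.
Context {R : realType} {d : nat}.
Local Notation E := 'rV[R]_d.
Local Notation mu := (@lebesgue_rV R d).
Implicit Types (u v : R -> E -> R[i]).

Definition curve_continuous (N : (E -> R[i]) -> \bar R) (I : set R) u : Prop :=
  forall t, I t ->
    N (fun x => u s x - u t x) @[s --> within I (nbhs t)] --> 0%E.

Definition L2_deriv_on (I : set R) u v : Prop := forall t, I t ->
  L2norm (fun x => ((s - t)^-1)%:C%C * (u s x - u t x) - v t x)
    @[s --> within I t^'] --> 0%E.

(* du is the time derivative of u. *)
Definition B_solution (T : R) (k1 k2 : R -> R) (u0 : E -> R[i]) u : Prop :=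
  let I := `[0, T]%classic in
  [/\ (forall t, I t -> inB (u t)),
      curve_continuous Bnorm I u,
      {ae mu, forall x, u 0 x = u0 x} &
      exists du : R -> E -> R[i],
        [/\ (forall t, I t -> inL2 (du t)),
            curve_continuous L2norm I du,
            L2_deriv_on I u du &
            forall t, 0 < t <= T -> {ae mu, forall x,
              du t x + 'i%C * (- (k1 t)%:C%C * laplacian (u t) x
                               + (k2 t * sqnorm x)%:C%C * u t x) = 0}]].

(* By Tonelli this is the norm of L2((0, T) x omega); the iterated integral
   does not require a jointly measurable representative of u. *)
Definition spacetime_norm (T : R) (omega : set E) u : \bar R :=
  ((\int[lebesgue_measure]_(t in `]0%R, T[)
      \int[mu]_(x in omega) (Normc.normc (u t x) ^+ 2)%:E) `^ 2^-1)%E.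

(* Multi-indices n with entries in {0, ..., N} and |n| <= N. *)
Definition multi_le (N : nat) (n : {ffun 'I_d -> 'I_N.+1}) : bool :=
  (\sum_i n i <= N)%N.

Definition mvec (N : nat) (n : {ffun 'I_d -> 'I_N.+1}) : E :=
  \row_i (n i)%:R.

Definition gaussian_sum (N : nat) (a : {ffun 'I_d -> 'I_N.+1} -> E)
    (c : {ffun 'I_d -> 'I_N.+1} -> R) : E -> R :=
  fun x => \sum_(n | multi_le n) c n * expR (- sqnorm (x + a n)).

(* Membership of f in the class of initial data, with the witnesses explicit. *)
Definition class_A (f : E -> R[i]) (N : nat) (eta : R)
    (a : {ffun 'I_d -> 'I_N.+1} -> E) (c : {ffun 'I_d -> 'I_N.+1} -> R) : Prop :=
  [/\ inB f, (2 < N)%N, 0 < eta < 1, (forall n, multi_le n -> 0 <= c n) &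
      (L2norm (fun x => f x - (gaussian_sum a c x)%:C%C)%R <= eta%:E)%E].

End schroedinger.

Section smallness.
Context {R : realType}.

Definition gauss_rate (y2 y3 : R) : R := 2 * `|y2| ^+ 2 / (1 + 16 * y3 ^+ 2).

Definition eps_small (N : nat) (eps R0 y2 y3 : R) : Prop :=
  eps * N%:R *
    (Num.sqrt (1 + 16 * y3 ^+ 2) / (2 * `|y2|)
       * expR ((2 * `|y2| ^+ 2 * R0 ^+ 2 + 2 * `|y2| * N%:R * R0)
               / (1 + 16 * y3 ^+ 2))
     + Num.sqrt (2 * pi) * ((N%:R + 1) / `|y2|)
       * expR (2 * N%:R ^+ 2 / (1 + 16 * y3 ^+ 2)))
  <= 2^-1 * \int[lebesgue_measure]_(r in `[R0, +oo[)
              expR (- gauss_rate y2 y3 * r ^+ 2).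

End smallness.

(* Main.v *)
Require Import Defs.
From mathcomp Require Import all_boot all_order all_algebra.
From mathcomp Require Import all_classical all_reals all_analysis.
From mathcomp.real_closed Require Import complex.
From mathcomp Require Import measurable_realfun ring lra.
Import Order.TTheory GRing.Theory Num.Theory.
Import numFieldNormedType.Exports.
Local Open Scope classical_set_scope.
Local Open Scope ring_scope.

(** Neither unitarity nor the explicit propagator is needed. Fix a nonnegative
    test function phi supported in omega and put F(t) = Re <u(t), phi>. The
    equation in weak form expresses F' as the pairing of Im u(t) with
    -kappa_1 Delta phi + kappa_2 |x|^2 phi, which is again supported in omega, so
    F^2 and (F')^2 are both bounded by A h^2, where h(t) is the norm of u(t) in
    L^2(omega). Hence - d/dt [(T - t) F^2] = F^2 - 2 (T - t) F F'
    <= A (1 + 2 T) h^2, and integrating bounds F(0) = Re <u_0, phi> by the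
    space-time norm of u. Smallness of eps at t = 0 (where y_2 = 1 and y_3 = 0)
    gives eps N <= 1, so the Gaussians of the sum g approximating u_0 have their
    centers in a fixed cube; as their coefficients c_n are nonnegative, both
    ||g|| and <g, phi> are comparable to the sum of the c_n, so that
    ||u_0|| - eta <= ||g|| is controlled by <g, phi> <= F(0) + ||phi|| eta. *)

(** * Flat functions *)

Section flat.
Context {R : realType}.
Implicit Types (P : {poly R}) (s t : R).

(** Since s^n / n! is one term of the exponential series, s^n exp(-s) <= n! for s >= 0. Weighting by
    the coefficients of P gives the bound. *)
Lemma horner_expR_bounded P :
  exists M : R, forall s, 0 <= s -> `|P.[s]| * expR (- s) <= M.
Proof.
exists (\sum_(i < size P) `|P`_i| * i`!%:R) => s s0.
rewrite horner_coef (le_trans (ler_wpM2r (expR_ge0 _) (ler_norm_sum _ _ _)))//.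
rewrite mulr_suml ler_sum// => i _; rewrite normrM -mulrA ler_wpM2l//.
rewrite ger0_norm ?exprn_ge0// expRN ler_pdivrMr ?expR_gt0//.
case: i => -[|n] /= _; first by rewrite fact0 mul1r expr0 -expR0 ler_expR.
rewrite mulrC -ler_pdivrMr ?ltr0n ?fact_gt0//.
by rewrite (le_trans _ (expR_ge1Dxn n s0))// lerDr.
Qed.

(* For P = 1 this is the smooth function t |-> e^(-1/t) extended by 0; the
   polynomial factor makes the family stable under derivation. *)
Definition flat P t : R := if 0 < t then P.[t^-1] * expR (- t^-1) else 0.

Lemma flat_le0 P t : t <= 0 -> flat P t = 0.
Proof. by rewrite /flat ltNge => ->. Qed.

Lemma flat_bounded P : exists M : R, forall t, `|flat P t| <= M.
Proof.
have [M PM] := horner_expR_bounded P; exists M => t; rewrite /flat.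
case: ifPn => [t0|_].
  by rewrite normrM [`|expR _|]ger0_norm ?expR_ge0// PM// invr_ge0 ltW.
by rewrite normr0 (le_trans _ (PM 0 _))// mulr_ge0// expR_ge0.
Qed.

(** Factoring out t costs only a change of polynomial. As every [flat] function is bounded, this
    yields both the limit and the derivative at 0. *)
Lemma flat_mulX P t : t != 0 -> flat P t = t * flat ('X * P) t.
Proof.
by move=> t0; rewrite /flat; case: ifP; rewrite ?mulr0// hornerM hornerX !mulrA
  divff ?mul1r.
Qed.

Lemma flat_cvg0 P : flat P s @[s --> (0:R)] --> (0:R).
Proof.
have [M PM] := flat_bounded ('X * P).
suff h (e : R) : 0 < e -> \forall s \near (0 : R), `|flat P s| <= e.
  by apply/cvgr0Pnorm_le => e; exact: h.
have M1 : 0 < M + 1 by rewrite ltr_wpDl// (le_trans _ (PM 0)).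
move=> e0; near=> s.
have [->|s0] := eqVneq s 0; first by rewrite flat_le0// normr0 ltW.
rewrite flat_mulX// normrM.
rewrite (@le_trans _ _ (e / (M + 1) * (M + 1)))//; last by rewrite divfK// gt_eqF.
rewrite ler_pM//; last by rewrite (le_trans (PM s))// lerDl.
near: s; apply: (@nbhs0_le _ R^o); exact: divr_gt0.
Unshelve. all: by end_near. Qed.

(** For t > 0 the chain rule turns P(1/t) exp(-1/t) into t^-2 (P - P')(1/t) exp(-1/t). For t < 0 the
    function is locally zero, and t = 0 is treated by its difference quotients. *)
Lemma is_derive_flat P t : is_derive t 1 (flat P) (flat ('X^2 * (P - P^`())) t).
Proof.
have [t0|t0|->] := ltgtP t 0.
- have tf : \near t, cst 0 t = flat P t.
    near=> s; rewrite /= flat_le0// ltW//; near: s.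
    exact: lt_nbhsl.
  apply: (@near_eq_is_derive R R^o R^o _ _ t 1 _ tf).
  by rewrite flat_le0 1?ltW//; exact: is_derive_cst.
- have tf : \near t, P.[t^-1] * expR (- t^-1) = flat P t.
    near=> s; rewrite /flat ifT//; near: s.
    exact: lt_nbhsr.
  apply: (@near_eq_is_derive R R^o R^o _ _ t 1 _ tf).
  have tn : t != 0 by rewrite gt_eqF.
  have dV : is_derive t 1 (fun s : R => s^-1) (- t ^- 2).
    have := @is_deriveV _ (@id R) t 1 1 tn (is_derive_id _ _).
    by rewrite /GRing.scale/= mulr1.
  have dP : is_derive t 1 (fun s : R => P.[s^-1]) (P^`().[t^-1] * - t ^- 2).
    exact: (is_derive1_comp (f := horner P)).
  have dN : is_derive t 1 (fun s : R => - s^-1) (t ^- 2).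
    by rewrite -[t ^- 2]opprK; exact: is_deriveN.
  have dE : is_derive t 1 (fun s : R => expR (- s^-1)) (expR (- t^-1) * t ^- 2).
    exact: (is_derive1_comp (f := expR)).
  apply: (@is_derive_eq _ R^o R^o _ _ _ _ _ (is_deriveM dP dE)).
  rewrite /flat t0 !hornerE /GRing.scale/= exprVn; ring.
(* By [flat_mulX] the difference quotient of [flat P] at 0 is [flat ('X * P)], which tends to its
   value 0. *)
- apply/is_derive1_caratheodory; exists (flat ('X * P)); split.
  + move=> z; rewrite (@flat_le0 _ 0)// !subr0.
    have [->|z0] := eqVneq z 0; first by rewrite flat_le0// mulr0.
    by rewrite flat_mulX// mulrC.
  + by rewrite /prop_for /continuous_at flat_le0//; exact: flat_cvg0.
  + by rewrite !flat_le0.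
Unshelve. all: by end_near. Qed.

Lemma continuous_flat P : continuous (flat P).
Proof.
move=> t; apply/differentiable_continuous/derivable1_diffP.
by have [] := is_derive_flat P t.
Qed.

Lemma flat1_ge t : 1 <= t -> expR (- 1) <= flat 1 t.
Proof.
move=> t1; have t0 : 0 < t by rewrite (lt_le_trans ltr01).
by rewrite /flat t0 hornerC mul1r ler_expR lerN2 invf_le1.
Qed.

Lemma flat1_ge0 t : 0 <= flat 1 t.
Proof. by rewrite /flat; case: ifP => // _; rewrite hornerC mul1r expR_ge0. Qed.

End flat.

(** * The algebra of smooth functions generated by flat functions *)

Section flat_algebra.
Context {R : realType} {d : nat}.
Local Notation E := 'rV[R]_d.
Implicit Types (f g : E -> R) (x v : E).

(** A syntactic class stable under partial derivatives, so that smoothness, which concerns all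
    iterated partials, follows by induction. The affine change a x_i + b provides the translations
    and reflections used in the bump. *)
Inductive flat_algebra : (E -> R) -> Prop :=
| flat_algebra_cst (k : R) : flat_algebra (cst k)
| flat_algebra_coord (a b : R) (i : 'I_d) P :
    flat_algebra (fun x => flat P (a * x ord0 i + b))
| flat_algebra_add f g :
    flat_algebra f -> flat_algebra g -> flat_algebra (f \+ g)
| flat_algebra_mul f g :
    flat_algebra f -> flat_algebra g -> flat_algebra (f \* g).

Lemma flat_algebra_measurable f : flat_algebra f -> measurable_fun setT f.
Proof.
elim=> [k|a b i P|{}f g _ mf _ mg|{}f g _ mf _ mg].
- exact: measurable_cst.
- apply: (@measurableT_comp _ _ _ _ _ _ (flat P)).
    apply: continuous_measurable_fun; exact: continuous_flat.
  apply: measurable_funD => //; apply: measurable_funM => //.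
  exact: measurable_rV_coord.
- exact: measurable_funD.
- exact: measurable_funM.
Qed.

Lemma flat_algebra_bounded f : flat_algebra f -> exists M : R, forall x, `|f x| <= M.
Proof.
elim=> [k|a b i P|{}f g _ [M fM] _ [N gN]|{}f g _ [M fM] _ [N gN]].
- by exists `|k|.
- by have [M PM] := flat_bounded P; exists M.
- by exists (M + N) => x; rewrite (le_trans (ler_normD _ _))// lerD.
- by exists (M * N) => x; rewrite normrM ler_pM.
Qed.

Lemma flat_algebra_continuous f : flat_algebra f -> continuous f.
Proof.
elim=> [k|a b i P|{}f g _ cf _ cg|{}f g _ cf _ cg].
- exact: cst_continuous.
- move=> x; apply: (@continuous_comp _ _ _ (fun x : E => a * x ord0 i + b) (flat P)).
    have FF := nbhs_filter x.
    apply: (@cvgD _ R^o _ (nbhs x)); last exact: cvg_cst.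
    by apply: cvgM; [exact: cvg_cst|exact: coord_continuous].
  exact: continuous_flat.
- by move=> x; apply: (@cvgD _ R^o _ (nbhs x)); [exact: cf|exact: cg].
- by move=> x; apply: (@cvgM _ _ (nbhs x)); [exact: cf|exact: cg].
Qed.

(** Restriction to a line through x reduces generators depending on one coordinate to the
    one-variable chain rule. *)
Lemma is_derive_line f x v (df : R) :
  is_derive (0 : R) 1 (fun h : R => f (h *: v + x) : R^o) df ->
  is_derive x v (f : E -> R^o) df.
Proof.
case=> fd dfE; split; first by apply/derivable1P.
rewrite -dfE /derive.
set g1 := fun h => h^-1 *: _; set g2 := fun h => h^-1 *: _.
suff -> : g1 = g2 by [].
by rewrite funeqE /g1 /g2 => h /=; rewrite addr0 scale0r add0r [_%:A]mulr1.
Qed.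

Lemma flat_algebra_is_derive f v : flat_algebra f ->
  exists2 f', flat_algebra f' & forall x, is_derive x v f (f' x).
Proof.
elim=> [k|a b i P|{}f g Af [f' Af' ff'] Ag [g' Ag' gg']
  |{}f g Af [f' Af' ff'] Ag [g' Ag' gg']].
- exists (cst 0); first exact: flat_algebra_cst.
  by move=> x; exact: is_derive_cst.
- pose Q := 'X^2 * (P - P^`()).
  exists ((fun x => flat Q (a * x ord0 i + b)) \* cst (a * v ord0 i)).
    by apply: flat_algebra_mul; constructor.
  move=> x; apply: is_derive_line => /=.
  rewrite (_ : (fun h : R => _) =
      flat P \o (fun h => (a * v ord0 i) * h + (a * x ord0 i + b))); last first.
    by apply/funext => h /=; rewrite !mxE; congr flat; ring.
  apply: is_derive1_comp; first by rewrite mulr0 add0r; exact: is_derive_flat.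
  have := is_deriveD (is_deriveZ (a * v ord0 i) (is_derive_id (0 : R^o) 1))
    (is_derive_cst (a * x ord0 i + b) (0 : R^o) 1).
  by rewrite addr0 /GRing.scale/= mulr1.
- exists (f' \+ g'); first exact: flat_algebra_add.
  by move=> x; exact: is_deriveD.
- exists ((f \* g') \+ (g \* f')).
    by apply: flat_algebra_add; exact: flat_algebra_mul.
  by move=> x; exact: is_deriveM.
Qed.

Lemma flat_algebra_partial f i : flat_algebra f -> flat_algebra (partial i f).
Proof.
move=> Af; have [f' Af' ff'] := flat_algebra_is_derive _ (delta_mx ord0 i) Af.
rewrite (_ : partial i f = f')//; apply/funext => x.
by have [_] := ff' x.
Qed.

Lemma flat_algebra_smooth f : flat_algebra f -> smooth f.
Proof.
move=> Af s /=.
have As : flat_algebra (foldr partial f s).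
  by elim: s => // i s; exact: flat_algebra_partial.
split; first exact: flat_algebra_continuous.
move=> i x; have [f' _ ff'] := flat_algebra_is_derive _ (delta_mx ord0 i) As.
by have [] := ff' x.
Qed.

Lemma flat_algebra_mpartial f b : flat_algebra f -> flat_algebra (mpartial b f).
Proof.
rewrite /mpartial => Af; elim: (enum 'I_d) => //= i s As.
by elim: (nat_of_ord (b i)) => //= n; exact: flat_algebra_partial.
Qed.

(** The complement of K is open, so f vanishes on a whole neighbourhood of each of its points. *)
Lemma partial_eq0 (K : set E) f i : closed K ->
  (forall x, ~ K x -> f x = 0) -> forall x, ~ K x -> partial i f x = 0.
Proof.
move=> cK f0 x Kx; rewrite /partial (@near_eq_derive _ _ _ f (cst 0)).
  by have [] := is_derive_cst (0 : R^o) x (delta_mx ord0 i).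
have : nbhs x (~` K) by apply: open_nbhs_nbhs; split=> //; exact: closed_openC.
by apply: filterS => y; exact: f0.
Qed.

Lemma mpartial_eq0 (K : set E) f b : closed K ->
  (forall x, ~ K x -> f x = 0) -> forall x, ~ K x -> mpartial b f x = 0.
Proof.
move=> cK f0; rewrite /mpartial; elim: (enum 'I_d) => //= i s sK.
by elim: (nat_of_ord (b i)) => //= n; exact: partial_eq0.
Qed.

End flat_algebra.

(** * Cubes and a nonnegative bump supported in a cube *)

Section bump.
Context {R : realType} {d : nat}.
Local Notation E := 'rV[R]_d.
Local Notation mu := (@lebesgue_rV R d).
Implicit Types (a b rho : R) (x : E).

Definition cube a b : set E := [set x | forall i, `[a, b]%classic (x ord0 i)].

Lemma measurable_cube a b : measurable (cube a b).
Proof.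
rewrite (_ : cube a b = \bigcap_(i in [set: 'I_d]) (rV_coord i @^-1` `[a, b])).
  apply: fin_bigcap_measurable => // i _.
  by rewrite -[X in measurable X]setTI; exact: measurable_rV_coord.
by apply/seteqP; split=> [x ax i _|x ax i]; exact: ax.
Qed.

Lemma lebesgue_cube a b : a <= b -> mu (cube a b) = ((b - a) ^+ d)%:E.
Proof.
move=> ab; rewrite (@lebesgue_rV_box R d (fun=> `[a, b]%classic))//.
rewrite (eq_bigr (fun=> (b - a)%:E)).
  by rewrite prodEFin prodr_const card_ord.
by move=> i _; rewrite lebesgue_measure_itv/= lte_fin; case: ltgtP ab => // ->;
  rewrite subrr.
Qed.

Lemma compact_cube a b : compact (cube a b).
Proof.
apply: (@rV_compact R d (fun=> `[a, b]%classic)) => i; exact: segment_compact.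
Qed.

Lemma coord_le_sqnorm x i : `|x ord0 i| <= Num.sqrt (sqnorm x).
Proof.
rewrite -sqrtr_sqr ler_wsqrtr// /sqnorm (bigD1 i)//= lerDl sumr_ge0// => j _.
exact: sqr_ge0.
Qed.

(** One coordinate separates the two sets: it is at most r on [Omega], a closed condition inherited
    by the closure, and at least r + 1 on the cube. *)
Lemma cube_disjoint_closure (Omega : set E) r b :
  (0 < d)%N -> Omega `<=` eball r -> cube (r + 1) b `<=` ~` closure Omega.
Proof.
move=> d0 Or x xc; set i := Ordinal d0.
have cl : closed [set y : E | y ord0 i <= r].
  apply: (@closed_comp E R (fun y => y ord0 i) [set z | z <= r]).
    by move=> y _; exact: coord_continuous.
  exact: closed_le.
have Ocl : Omega `<=` [set y : E | y ord0 i <= r].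
  move=> y /Or /ltW; apply: le_trans; apply: le_trans (coord_le_sqnorm y i).
  exact: ler_norm.
move=> /(closureS Ocl); rewrite -(closure_id _).1//= => xr.
have := xc i; rewrite /= in_itv/= => /andP[+ _].
by apply/negP; rewrite -ltNge (le_lt_trans xr)// ltrDl.
Qed.

(** In each coordinate the factor is supported in [rho, rho + 3]. The length 3 leaves a middle unit
    interval where both arguments of [flat 1] are at least 1. *)
Definition bump rho x : R :=
  \prod_i (flat 1 (x ord0 i - rho) * flat 1 (rho + 3 - x ord0 i)).

Lemma flat_algebra_bump rho : flat_algebra (bump rho).
Proof.
rewrite /bump; elim: (index_enum _) => [|i s As].
  rewrite (_ : (fun _ => _) = cst 1); first exact: flat_algebra_cst.
  by apply/funext => x; rewrite big_nil.
rewrite (_ : (fun _ => _) = ((fun x => flat 1 (1 * x ord0 i + - rho)) \*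
    (fun x => flat 1 (- 1 * x ord0 i + (rho + 3)))) \*
    (fun x => \prod_(i <- s) (flat 1 (x ord0 i - rho) * flat 1 (rho + 3 - x ord0 i)))).
  by do 2?apply: flat_algebra_mul => //; exact: flat_algebra_coord.
by apply/funext => x; rewrite big_cons /= mul1r mulN1r [- _ + _]addrC.
Qed.

Lemma bump_ge0 rho x : 0 <= bump rho x.
Proof. by apply: prodr_ge0 => i _; rewrite mulr_ge0 ?flat1_ge0. Qed.

Lemma bump_eq0 rho x : ~ cube rho (rho + 3) x -> bump rho x = 0.
Proof.
move=> /existsNP[j]; rewrite /= in_itv/= => /negP; rewrite negb_and -!ltNge.
move=> xj; rewrite /bump (bigD1 j)//=; case/orP : xj => xj.
  by rewrite [flat 1 (_ - rho)]flat_le0 ?mul0r// subr_le0 ltW.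
by rewrite [flat 1 (rho + 3 - _)]flat_le0 ?mulr0 ?mul0r// subr_le0 ltW.
Qed.

(** Each coordinate contributes two values of [flat 1] at arguments at least 1, hence at least
    exp(-1) exp(-1). *)
Lemma bump_ge rho x : cube (rho + 1) (rho + 2) x -> expR (- 2) ^+ d <= bump rho x.
Proof.
move=> xc; rewrite -[X in _ ^+ X]card_ord -prodr_const ler_prod// => i _.
rewrite expR_ge0/= (_ : - 2 = - 1 + - 1) ?expRD; last by ring.
have := xc i; rewrite /= in_itv/= => /andP[x1 x2].
by rewrite ler_pM ?expR_ge0// flat1_ge//; lra.
Qed.

End bump.

(** * Pairings in L2 *)

Section integral_monotone.
Local Open Scope ereal_scope.
Context d (T : measurableType d) (R : realType) (mu : {measure set T -> \bar R}).
Import HBNNSimple.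

(* Monotonicity needs no measurability because the integral of a nonnegative
   function is the supremum over the simple functions below it. *)
Lemma ge0_le_integral_mono (A B : set T) (f g : T -> \bar R) :
  (forall x, 0 <= f x) -> (forall x, 0 <= g x) -> A `<=` B ->
  (forall x, A x -> f x <= g x) ->
  \int[mu]_(x in A) f x <= \int[mu]_(x in B) g x.
Proof.
move=> f0 g0 AB fg; rewrite integral_mkcond [leRHS]integral_mkcond.
have p0 (D : set T) (h : T -> \bar R) : (forall x, 0 <= h x) ->
    forall x : T, 0 <= (h \_ D) x.
  by move=> h0 x; rewrite patchE; case: ifP.
rewrite !ge0_integralTE; [|exact: p0..].
apply: ereal_sup_le => _ [h hf <-]; exists h => // x; rewrite (le_trans (hf x))// !patchE.
case: ifPn => [/set_mem Ax|_]; last by case: ifP.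
by rewrite mem_set; [exact: fg|exact: AB].
Qed.

End integral_monotone.

Section sqrt_ereal.
Context {R : realType}.
Local Open Scope ereal_scope.

Lemma le_poweR12 (x y : \bar R) : 0 <= x -> x <= y -> x `^ 2^-1 <= y `^ 2^-1.
Proof.
move=> x0 xy; apply: gt0_ler_poweR => //; rewrite in_itv/= leey andbT//.
exact: le_trans xy.
Qed.

Lemma poweR12_EFin (r : R) : (0 <= r)%R -> r%:E `^ 2^-1 = (Num.sqrt r)%:E.
Proof. by move=> r0; rewrite poweR_EFin powR12_sqrt. Qed.

Lemma Lnorm2E d (T : measurableType d) (mu : {measure set T -> \bar R}) (f : T -> R) :
  Lnorm mu 2%:E (EFin \o f) = (\int[mu]_x (f x ^+ 2)%:E) `^ 2^-1.
Proof.
rewrite unlock /Lnorm; congr (_ `^ _); apply: eq_integral => x _ /=.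
by rewrite powR_mulrn// -normrX ger0_norm// sqr_ge0.
Qed.

End sqrt_ereal.

Section pairing.
Context dT (T : measurableType dT) (R : realType).
Variable mu : {measure set T -> \bar R}.
Variables (K : set T) (M : R) (phi : T -> R).
Hypotheses (mK : measurable K) (Kfin : (mu K < +oo)%E) (M0 : 0 <= M).
Hypotheses (mphi : measurable_fun setT phi) (phiM : forall x, `|phi x| <= M).
Hypothesis (phi0 : forall x, ~ K x -> phi x = 0).
Implicit Type f : T -> R.

(** The square of phi is dominated by M^2 times the indicator of K. *)
Lemma Lnorm_bounded_le :
  (Lnorm mu 2%:E (EFin \o phi) <= (M * Num.sqrt (fine (mu K)))%:E)%E.
Proof.
have -> : M * Num.sqrt (fine (mu K)) = Num.sqrt (M ^+ 2 * fine (mu K)).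
  by rewrite sqrtrM ?sqr_ge0// sqrtr_sqr ger0_norm.
have muK0 : 0 <= fine (mu K) by rewrite fine_ge0.
rewrite Lnorm2E -poweR12_EFin ?mulr_ge0 ?sqr_ge0//.
apply: le_poweR12; first by apply: integral_ge0 => x _; rewrite lee_fin sqr_ge0.
rewrite EFinM fineK ?ge0_fin_numE// -integral_cst// [leRHS]integral_mkcond.
apply: ge0_le_integral_mono => // x; rewrite ?lee_fin ?sqr_ge0//.
  by rewrite patchE; case: ifP => // _; rewrite lee_fin sqr_ge0.
rewrite patchE; case: ifPn => [_|/negP Kx] _.
  by rewrite lee_fin -real_normK ?num_real// lerXn2r ?nnegrE.
by rewrite phi0 ?expr0n// => /mem_set.
Qed.

Lemma pairing_integrable f : measurable_fun setT f ->
  (Lnorm mu 2%:E (EFin \o f) < +oo)%E ->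
  mu.-integrable setT (EFin \o (f \* phi)).
Proof.
move=> mf f2; apply/Lfun1_integrable/Lfun2_mul_Lfun1.
  by apply/andP; split; rewrite inE.
apply/andP; split; rewrite inE//= /finite_norm.
by rewrite (le_lt_trans Lnorm_bounded_le)// ltry.
Qed.

(** Cauchy-Schwarz, in the form of Hoelder's inequality with both exponents 2. *)
Lemma pairing_le f : measurable_fun setT f ->
  (Lnorm mu 2%:E (EFin \o f) < +oo)%E ->
  (`|\int[mu]_x (f x * phi x)|%:E <=
     (M * Num.sqrt (fine (mu K)))%:E * Lnorm mu 2%:E (EFin \o f))%E.
Proof.
move=> mf f2; have ifphi := pairing_integrable f mf f2.
have : (Lnorm mu 1 (EFin \o (f \* phi)%R) <=
    Lnorm mu 2%:E (EFin \o f) * Lnorm mu 2%:E (EFin \o phi))%E.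
  by apply: hoelder => //; lra.
rewrite Lnorm1 => h; rewrite muleC.
apply: le_trans (lee_wpmul2l (Lnorm_ge0 _ _ _) Lnorm_bounded_le).
apply: le_trans h; rewrite EFin_normr_Rintegral//.
by apply: le_abse_integral => //; exact: measurable_int ifphi.
Qed.

(** The pairing does not change when f is cut off outside K, so Cauchy-Schwarz can be applied to the
    cut-off. This localization is what later brings in the observation region. *)
Lemma pairing_sqr_le f : measurable_fun setT f ->
  (Lnorm mu 2%:E (EFin \o f) < +oo)%E ->
  (((\int[mu]_x (f x * phi x)) ^+ 2)%:E <=
     (M ^+ 2 * fine (mu K))%:E * \int[mu]_(x in K) (f x ^+ 2)%:E)%E.
Proof.
move=> mf f2.
have -> : (\int[mu]_x (f x * phi x)) = \int[mu]_x ((f \_ K) x * phi x).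
  apply: eq_Rintegral => x _; rewrite patchE; case: ifPn => // /negP Kx.
  by rewrite phi0 ?mulr0// => /mem_set.
have mfK : measurable_fun setT (f \_ K).
  by apply/(measurable_restrictT _ _).1 => //; exact: measurable_funTS.
set I := (\int[mu]_(x in K) (f x ^+ 2)%:E)%E.
have I0 : (0 <= I)%E by apply: integral_ge0 => x _; rewrite lee_fin sqr_ge0.
have Ifin : (I < +oo)%E.
  apply: (@le_lt_trans _ _ (\int[mu]_x (f x ^+ 2)%:E)%E).
    by apply: ge0_le_integral_mono => // x; rewrite lee_fin sqr_ge0.
  apply: (@lty_poweRy _ _ 2^-1); first by rewrite invr_neq0.
  by rewrite -Lnorm2E.
have N2K : (Lnorm mu 2%:E (EFin \o (f \_ K)) = I `^ 2^-1)%E.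
  rewrite Lnorm2E; congr (_ `^ _)%E; rewrite /I [RHS]integral_mkcond.
  apply: eq_integral => x _; rewrite !patchE.
  by case: ifP => // _; rewrite expr0n.
have := pairing_le (f \_ K) mfK; rewrite N2K => /(_ (poweR_lty _ Ifin)).
have IE : I = (fine I)%:E by rewrite fineK// ge0_fin_numE.
have fI0 : 0 <= fine I by exact: fine_ge0.
rewrite IE poweR12_EFin// -!EFinM !lee_fin => h.
rewrite -real_normK ?num_real//.
rewrite (le_trans (lerXn2r 2 _ _ h)) ?nnegrE ?mulr_ge0//.
by rewrite !exprMn !sqr_sqrtr// fine_ge0.
Qed.

End pairing.

(** * Gaussian sums *)

Section gaussian.
Context {R : realType}.
Local Notation mu := (@lebesgue_rV R _).

Lemma measurable_sqnorm n : measurable_fun setT (@sqnorm R n).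
Proof.
rewrite /sqnorm; apply: measurable_sum => i.
by apply: measurable_funX; exact: measurable_rV_coord.
Qed.

Lemma sqnorm_rV_cons n (p : R * 'rV[R]_n) :
  sqnorm (rV_cons p) = p.1 ^+ 2 + sqnorm p.2.
Proof.
rewrite /sqnorm big_ord_recl; congr (_ ^+ 2 + _).
  by have [] := congr1 fst (rV_consK p).
apply: eq_bigr => i _; rewrite /rV_cons (_ : lift ord0 i = rshift 1 i).
  by rewrite (row_mxEr (const_mx p.1 : 'rV_1)).
exact: val_inj.
Qed.

(** The measure on R^(n+1) is a product measure pushed forward by [rV_cons], so this is a change of
    variables followed by Tonelli. *)
Lemma integral_lebesgue_rVS n (f : 'rV[R]_n.+1 -> \bar R) :
  measurable_fun setT f -> (forall x, 0 <= f x)%E ->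
  (\int[lebesgue_rV n.+1]_x f x =
   \int[lebesgue_measure]_r \int[lebesgue_rV n]_v f (rV_cons (r, v)))%E.
Proof.
move=> mf f0.
pose m1 : {sigma_finite_measure set (measurableTypeR R) -> \bar R} :=
  @lebesgue_measure R.
have mc : @measurable_fun _ _ (measurableTypeR R * 'rV[R]_n)%type 'rV[R]_n.+1
    setT (@rV_cons R n) by exact: (@measurable_rV_cons R n).
pose P := [the {measure set _ -> \bar R} of (m1 \x lebesgue_rV n)%E].
have := @ge0_integral_pushforward _ _ _ _ R _ mc P _ _ measurableT mf.
rewrite preimage_setT => push.
transitivity (\int[P]_p f (rV_cons p))%E.
  by rewrite -push//; exact: eq_measure_integral.
by rewrite /P fubini_tonelli1//; exact: measurableT_comp.
Qed.

(** Induction on the dimension, splitting off one Gaussian factor at a time; in dimension 0 the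
    measure is a Dirac mass. *)
Lemma lebesgue_rV_gauss n :
  (\int[@lebesgue_rV R n]_x (expR (- sqnorm x))%:E = (Num.sqrt pi ^+ n)%:E)%E.
Proof.
have mE m : measurable_fun setT (fun x : 'rV[R]_m => (expR (- sqnorm x))%:E).
  apply/measurable_EFinP; apply: measurableT_comp => //.
  by apply: measurableT_comp => //; exact: measurable_sqnorm.
elim: n => [|n IH].
  rewrite [LHS]integral_dirac; [|by []|exact: mE].
  by rewrite [X in (X * _)%E]diracT mul1e /sqnorm big_ord0 oppr0 expR0.
rewrite integral_lebesgue_rVS//.
under eq_integral => r _.
  under eq_integral => v _ do rewrite sqnorm_rV_cons/= opprD expRD EFinM.
  rewrite ge0_integralZl//; [|exact: mE].
  rewrite IH; over.
rewrite ge0_integralZr//=; last by apply/measurable_EFinP; exact: measurable_gauss_fun.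
by rewrite integralT_gauss -EFinM exprS.
Qed.

(** In the bracket the term with sqrt(2 pi) is already at least 1. On the right, half the integral
    of exp(-2 r^2) is at most sqrt(pi) / 2 <= 1, because pi < 4. *)
Lemma eps_small_le1 N (eps R0 : R) : 0 < eps -> (0 < N)%N -> 0 < R0 ->
  eps_small N eps R0 1 0 -> eps * N%:R <= 1.
Proof.
move=> eps0 N0 R00; rewrite /eps_small /gauss_rate.
rewrite normr1 expr1n expr0n/= mulr0 addr0 !divr1 !mulr1.
set I := (X in _ <= _ * X) => small.
have I2 : I <= 2.
  have pi4 : Num.sqrt pi <= 2 :> R.
    rewrite -[leRHS]ger0_norm// -sqrtr_sqr ler_wsqrtr//.
    by have := @pihalf_02 R; lra.
  have J : (\int[lebesgue_measure]_(r in `[R0, +oo[) (expR (- 2 * r ^+ 2))%:E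
      <= (2 : R)%:E)%E.
    apply: (@le_trans _ _ (\int[lebesgue_measure]_r (gauss_fun r)%:E)%E).
      apply: ge0_le_integral_mono => // [r|r _]; first exact: gauss_fun_ge0.
      by rewrite lee_fin ler_expR; have := sqr_ge0 r; lra.
    by rewrite integralT_gauss lee_fin.
  rewrite /I /Rintegral -lee_fin fineK// ge0_fin_numE.
    by rewrite (le_lt_trans J)// ltry.
  by apply: integral_ge0 => r _; rewrite lee_fin expR_ge0.
have e1 : 1 <= expR (2 * N%:R ^+ 2) :> R.
  by rewrite -expR0 ler_expR mulr_ge0// exprn_ge0.
have s1 : 1 <= Num.sqrt (2 * pi) :> R.
  by rewrite -[leLHS]sqrtr1 ler_wsqrtr//; have := @pi_ge2 R; lra.
have N1 : 1 <= N%:R + 1 :> R by rewrite lerDr.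
apply: le_trans (_ : eps * N%:R * 1 <= _); first by rewrite mulr1.
apply: le_trans (le_trans small _); last by lra.
rewrite ler_wpM2l ?mulr_ge0 ?(ltW eps0)//.
rewrite ler_wpDl ?mulr_ge0 ?sqrtr_ge0 ?expR_ge0//.
by rewrite !mulr_ege1.
Qed.

Context {d : nat}.
Variables (N : nat) (eps : R) (a : {ffun 'I_d -> 'I_N.+1} -> 'rV[R]_d)
  (c : {ffun 'I_d -> 'I_N.+1} -> R).
Hypotheses (eps0 : 0 < eps) (epsN : eps * N%:R <= 1).
Hypothesis aE : forall n, multi_le n -> a n = eps *: mvec n.
Hypothesis c0 : forall n, multi_le n -> 0 <= c n.
Local Notation mass := (\sum_(n | multi_le n) c n).

Lemma center_ge0_le1 n i : multi_le n -> 0 <= a n ord0 i <= 1.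
Proof.
move=> nN; rewrite aE// !mxE; apply/andP; split.
  by rewrite mulr_ge0 ?ler0n// ltW.
rewrite (le_trans _ epsN)// ler_wpM2l//; first exact: ltW.
by rewrite ler_nat -ltnS ltn_ord.
Qed.

(** In each coordinate -(x + a)^2 <= 1 - x^2 / 2, which follows from (x + 2a)^2 >= 0 and a^2 <= 1.
    The d summands 1 produce the factor exp(d). *)
Lemma gaussian_sum_le x :
  gaussian_sum a c x <= mass * expR d%:R * expR (- (2^-1 * sqnorm x)).
Proof.
rewrite /gaussian_sum -mulrA mulr_suml ler_sum// => n nN.
rewrite ler_wpM2l ?c0// -expRD ler_expR.
have -> : d%:R = \sum_(i < d) 1 :> R by rewrite sumr_const card_ord.
rewrite /sqnorm mulr_sumr -!sumrB.
rewrite -sumrN ler_sum// => i _; rewrite !mxE.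
have /andP[a0 a1] := center_ge0_le1 n i nN.
have := sqr_ge0 (x ord0 i + 2 * a n ord0 i); have := mulr_ile1 a0 a0 a1 a1.
nra.
Qed.

(** On this cube every coordinate of x + a_n lies between 0 and rho + 3, as the coordinates of a_n
    lie in [0, 1]. *)
Lemma gaussian_sum_ge rho x : 0 <= rho -> cube (rho + 1) (rho + 2) x ->
  mass * expR (- ((rho + 3) ^+ 2 * d%:R)) <= gaussian_sum a c x.
Proof.
move=> rho0 xc; rewrite /gaussian_sum mulr_suml ler_sum// => n nN.
rewrite ler_wpM2l ?c0// ler_expR lerN2 /sqnorm.
have -> : d%:R = \sum_(i < d) 1 :> R by rewrite sumr_const card_ord.
rewrite mulr_sumr ler_sum// => i _.
rewrite mulr1 !mxE.
have /andP[a0 a1] := center_ge0_le1 n i nN.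
have := xc i; rewrite /= in_itv/= => /andP[x1 x2].
by rewrite lerXn2r ?nnegrE; lra.
Qed.

Lemma gaussian_sum_ge0 x : 0 <= gaussian_sum a c x.
Proof. by apply: sumr_ge0 => n nN; rewrite mulr_ge0 ?c0 ?expR_ge0. Qed.

Lemma measurable_gaussian_sum : measurable_fun setT (gaussian_sum a c).
Proof.
rewrite (_ : gaussian_sum a c = fun x =>
    \sum_(n <- [seq n <- index_enum _ | multi_le n])
      c n * expR (- sqnorm (x + a n))); last first.
  by apply/funext => x; rewrite big_filter.
apply: measurable_sum => n; apply: measurable_funM => //.
apply: measurableT_comp => //; apply: measurableT_comp => //.
apply: (measurableT_comp (@measurable_sqnorm _)).
apply: measurable_fun_rV => i; rewrite (_ : _ \o _ = rV_coord i \+ cst (a n ord0 i)).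
  by apply: measurable_funD => //; exact: measurable_rV_coord.
by apply/funext => x; rewrite /= /rV_coord mxE.
Qed.

End gaussian.

(** * Functions of time *)

Section relative_derivative.
Context {R : realType}.
Implicit Types (I : set R) (f g : R -> R) (t : R).

Lemma deriv_on_eps I f g t (e : R) : deriv_on I f g -> I t -> 0 < e ->
  exists2 del : R, 0 < del & forall s, I s -> `|s - t| < del -> s != t ->
    `|(s - t)^-1 * (f s - f t) - g t| < e.
Proof.
move=> fg It e0; have /cvgrPdist_lt/(_ e e0) := fg t It.
rewrite !near_withinE => /nbhs_ballP[del /= del0 H]; exists del => // s Is st sNt.
by rewrite distrC; apply: H => //; rewrite /ball/= distrC.
Qed.

Lemma deriv_on_cvg I f g t : deriv_on I f g -> I t ->
  f s @[s --> within I (nbhs t)] --> f t.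
Proof.
move=> fg It; have [del del0 H] := deriv_on_eps I f g t 1 fg It ltr01.
suff h (e : R) : 0 < e -> \forall s \near within I (nbhs t), `|f t - f s| < e.
  by apply/cvgrPdist_lt => e; exact: h.
(* Near t the difference quotient is within 1 of g(t), so C is a local Lipschitz constant at t. *)
move=> e0; set C := `|g t| + 1.
have C0 : 0 < C by rewrite ltr_wpDl.
rewrite near_withinE; apply/nbhs_ballP; exists (Num.min del (e / C)) => /=.
  by rewrite lt_min del0 divr_gt0.
move=> s; rewrite /ball/= lt_min => /andP[st1 st2] Is.
have [->|sNt] := eqVneq s t; first by rewrite subrr normr0.
have := H s Is; rewrite distrC st1 => /(_ isT sNt) q1.
have sN0 : s - t != 0 by rewrite subr_eq0.
rewrite distrC -[f s - f t](mulVKf sN0) normrM.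
rewrite (@lt_le_trans _ _ (e / C * C))//; last by rewrite divfK// gt_eqF.
rewrite ltr_pM//; first by rewrite distrC.
rewrite -[X in `|X|](subrK (g t)) (le_lt_trans (ler_normD _ _))// /C addrC.
by rewrite ltrD2l.
Qed.

Lemma deriv_on_within_continuous I f g : deriv_on I f g ->
  {within I, continuous f}.
Proof. by move=> fg; apply/subspace_continuousP => t; exact: deriv_on_cvg fg. Qed.

Lemma deriv_on_is_derive (T : R) f g t : deriv_on `[0, T] f g -> 0 < t < T ->
  is_derive t 1 f (g t).
Proof.
move=> fg /andP[t0 tT].
have It : `[0, T]%classic t by rewrite /= in_itv/= !ltW.
have cv : h^-1 *: (f (h *: 1 + t) - f t) @[h --> (0 : R)^'] --> g t.
  suff H (e : R) : 0 < e ->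
      \forall h \near (0 : R)^', `|g t - h^-1 *: (f (h *: 1 + t) - f t)| < e.
    by apply/cvgrPdist_lt => e; exact: H.
  move=> e0; have [del del0 H] := deriv_on_eps `[0, T] f g t e fg It e0.
  rewrite near_withinE; apply/nbhs_ballP.
  (* This radius keeps t + h inside [0, T], where the relative derivative is available. *)
  exists (Num.min del (Num.min t (T - t))) => /=.
    by rewrite !lt_min del0 t0 subr_gt0.
  move=> h; rewrite /ball/= sub0r normrN !lt_min => /and3P[hd ht hT] hN0.
  have ht' := ler_norm (- h); have hT' := ler_norm h; rewrite normrN in ht'.
  have := H (h *: 1 + t); rewrite addrK distrC /GRing.scale/= mulr1; apply => //.
    by rewrite in_itv/=; apply/andP; split; lra.
  by rewrite -subr_eq0 addrK.
by apply: DeriveDef; [apply/cvg_ex; exists (g t)|exact: cvg_lim cv].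
Qed.

(** Continuity on the compact interval makes the set of values bounded, so that [sup] is a genuine
    upper bound and not its default value. *)
Lemma le_supnorm (T : R) f t : {within `[0, T], continuous f} -> 0 <= t <= T ->
  `|f t| <= supnorm T f.
Proof.
move=> cf tT; have T0 : 0 <= T by have /andP[/le_trans] := tT; apply.
have cnf : {within `[0, T], continuous (fun s => `|f s|)}.
  apply/subspace_continuousP => s Is; apply: cvg_norm.
  by move/subspace_continuousP : cf; exact.
have [m mT fm] := EVT_max T0 cnf.
apply: ub_le_sup; last by exists t.
by exists `|f m| => _ [s sT <-]; exact: fm.
Qed.

(** If the set of values is empty or unbounded, [sup] defaults to 0; otherwise it dominates some
    absolute value. *)
Lemma supnorm_ge0 (T : R) f : 0 <= supnorm T f.
Proof.
rewrite /supnorm; set S := [set _ | _ in _].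
have [Ssup|/sup_out->//] := pselect (has_sup S).
have [[x Sx] ubS] := Ssup.
apply: le_trans (ub_le_sup ubS Sx).
by case: Sx => s _ <-.
Qed.

(** The weight t - T in G = (t - T) F^2 kills the boundary term at T, so integrating G' = q leaves T
    F(0)^2. As [H] may be non-measurable, it is compared with the positive part of q by monotonicity
    alone. *)
Lemma sqr_initial_le (T A : R) (F D : R -> R) (H : R -> \bar R) :
  0 < T -> 0 < A -> deriv_on `[0, T] F D -> {within `[0, T], continuous D} ->
  (forall t, 0 <= H t)%E ->
  (forall t, 0 < t < T -> ((F t ^+ 2)%:E <= A%:E * H t)%E) ->
  (forall t, 0 < t < T -> ((D t ^+ 2)%:E <= A%:E * H t)%E) ->
  ((T * F 0 ^+ 2)%:E <=
     (A * (1 + 2 * T))%:E * \int[lebesgue_measure]_(t in `]0%R, T[) H t)%E.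
Proof.
move=> T0 A0 FD cD H0 FH DH.
pose q t := F t ^+ 2 - 2 * (T - t) * (F t * D t).
pose G t := (t - T) * (F t * F t).
have cF := deriv_on_within_continuous _ _ _ FD.
have cvF := (subspace_continuousP _ _).1 cF.
have cvD := (subspace_continuousP _ _).1 cD.
have cvid t : (s : R) @[s --> within `[0, T] (nbhs t)] --> t by exact: cvg_within.
have cq : {within `[0, T], continuous q}.
  apply/subspace_continuousP => t It; rewrite /q.
  apply: cvgB; first by apply: cvgM; exact: cvF.
  apply: cvgM; last by apply: cvgM; [exact: cvF|exact: cvD].
  by apply: cvgM; [exact: cvg_cst|apply: cvgB; [exact: cvg_cst|exact: cvid]].
have cG : {within `[0, T], continuous G}.
  apply/subspace_continuousP => t It; rewrite /G.
  apply: cvgM; first by apply: cvgB; [exact: cvid|exact: cvg_cst].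
  by apply: cvgM; exact: cvF.
have dG t : 0 < t < T -> is_derive t 1 G (q t).
  move=> tT; have dF := deriv_on_is_derive T F D t FD tT.
  have dT : is_derive t 1 (fun s : R => s - T) (1 - 0).
    by apply: is_deriveB; exact: is_derive_cst.
  apply: (@is_derive_eq _ R^o R^o _ _ _ _ _ (is_deriveM dT (is_deriveM dF dF))).
  rewrite /q !fctE /GRing.scale/=. ring.
have FTC : (\int[lebesgue_measure]_(t in `[0%R, T]) (q t)%:E = (T * F 0 ^+ 2)%:E)%E.
  rewrite (continuous_FTC2 (F := G) T0 cq).
  - by rewrite -EFinB /G subrr mul0r !sub0r mulNr opprK expr2.
  - have [_ G0 GT] := (continuous_within_itvP G T0).1 cG.
    by split=> // t; rewrite in_itv/= => /dG[].
  - move=> t; rewrite in_itv/= => /dG[_ dGt].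
    by rewrite derive1E.
have C0 : 0 < A * (1 + 2 * T) by rewrite mulr_gt0// addr_gt0 ?mulr_gt0.
have mq : measurable_fun `]0, T[ q.
  apply: (measurable_funS (measurable_itv `[0, T])).
    exact: subset_itv_oo_cc.
  exact: subspace_continuous_measurable_fun.
rewrite -FTC integral_itv_bndoo; last exact/measurable_EFinP.
rewrite integralE; set C := A * _.
have qp : (\int[lebesgue_measure]_(t in `]0%R, T[) (EFin \o q)^\+ t <=
    C%:E * \int[lebesgue_measure]_(t in `]0%R, T[) H t)%E.
  (* The constant is moved to the side of q, which is measurable, so that it can be taken inside the
     integral. *)
  rewrite -lee_pdivrMl//.
  rewrite -ge0_integralZl_EFin//; last 2 first.
  - by apply: measurable_funepos; exact/measurable_EFinP.
  - by rewrite invr_ge0 ltW.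
  apply: ge0_le_integral_mono => // t.
    by rewrite mule_ge0// lee_fin invr_ge0 ltW.
  rewrite /= in_itv/= => tT; rewrite lee_pdivrMl// funeposE/=.
  have := H0 t; have := FH t tT; have := DH t tT; case: (H t) => [h| |]//.
    rewrite -!EFinM !lee_fin => Dh Fh h0.
    rewrite -EFin_max lee_fin ge_max mulr_ge0// ?(ltW C0)// andbT /q /C.
    (* From (F + D)^2 >= 0 one gets -2 F D <= F^2 + D^2 <= 2 A h, while 0 < T - t < T. *)
    have := sqr_ge0 (F t + D t); have /andP[t0 tT'] := tT.
    nra.
  by move=> _ _ _; rewrite gt0_muley ?leey ?lte_fin.
apply: le_trans qp; rewrite geeDl//.
by rewrite oppe_le0 integral_ge0.
Qed.

End relative_derivative.

(** * Complex-valued functions *)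

Section L2_pairing.
Context {R : realType} {d : nat}.
Local Notation E := 'rV[R]_d.
Local Notation mu := (@lebesgue_rV R d).
Implicit Types (u v w : E -> R[i]) (f g : E -> R).

Lemma sqr_normc_ReIm (z : R[i]) :
  Normc.normc z ^+ 2 = complex.Re z ^+ 2 + complex.Im z ^+ 2.
Proof. by case: z => p q /=; rewrite sqr_sqrtr// addr_ge0 ?sqr_ge0. Qed.

Lemma Lnorm2_mono f g : (forall x, f x ^+ 2 <= g x ^+ 2) ->
  (Lnorm mu 2%:E (EFin \o f) <= Lnorm mu 2%:E (EFin \o g))%E.
Proof.
move=> fg; rewrite !Lnorm2E; apply: le_poweR12.
  by apply: integral_ge0 => x _; rewrite lee_fin sqr_ge0.
by apply: ge0_le_integral_mono => // x; rewrite lee_fin ?sqr_ge0// => _; exact: fg.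
Qed.

Lemma Lnorm2_Re_le u : (Lnorm mu 2%:E (EFin \o (@complex.Re R \o u)) <= L2norm u)%E.
Proof.
apply: (Lnorm2_mono _ (@Normc.normc R \o u)) => x /=.
by rewrite sqr_normc_ReIm lerDl sqr_ge0.
Qed.

Lemma Lnorm2_Im_le u : (Lnorm mu 2%:E (EFin \o (@complex.Im R \o u)) <= L2norm u)%E.
Proof.
apply: (Lnorm2_mono _ (@Normc.normc R \o u)) => x /=.
by rewrite sqr_normc_ReIm lerDr sqr_ge0.
Qed.

Lemma inL2_Re u : inL2 u ->
  measurable_fun setT (@complex.Re R \o u) /\
  (Lnorm mu 2%:E (EFin \o (@complex.Re R \o u)) < +oo)%E.
Proof.
by move=> [mRe _ uoo]; split=> //; exact: le_lt_trans (Lnorm2_Re_le u) uoo.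
Qed.

Lemma inL2_Im u : inL2 u ->
  measurable_fun setT (@complex.Im R \o u) /\
  (Lnorm mu 2%:E (EFin \o (@complex.Im R \o u)) < +oo)%E.
Proof.
by move=> [_ mIm uoo]; split=> //; exact: le_lt_trans (Lnorm2_Im_le u) uoo.
Qed.

Lemma measurable_normc u : inL2 u -> measurable_fun setT (@Normc.normc R \o u).
Proof.
move=> [mRe mIm _].
rewrite (_ : _ \o _ = Num.sqrt \o
    (fun x => complex.Re (u x) ^+ 2 + complex.Im (u x) ^+ 2)).
  apply: measurableT_comp.
    by apply: continuous_measurable_fun; exact: sqrt_continuous.
  by apply: measurable_funD; exact: measurable_funX.
by apply/funext => x /=; case: (u x).
Qed.

(** Minkowski's inequality for the moduli, after the pointwise triangle inequality. *)
Lemma L2normD_le u v : inL2 u -> inL2 v ->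
  (L2norm (fun x => u x + v x)%R <= L2norm u + L2norm v)%E.
Proof.
move=> u2 v2; have mu' := measurable_normc u u2; have mv' := measurable_normc v v2.
apply: le_trans (minkowski_EFin mu mu' mv' (ler1n _ 2)).
apply: (Lnorm2_mono (@Normc.normc R \o (fun x => u x + v x))) => x /=.
have n0 (z : R[i]) : 0 <= Normc.normc z by case: z => p q; exact: sqrtr_ge0.
rewrite lerXn2r ?nnegrE ?addr_ge0//; exact: le_normcD.
Qed.

Lemma inL2D u v : inL2 u -> inL2 v -> inL2 (fun x => u x + v x).
Proof.
move=> u2 v2; have [ru iu uoo] := u2; have [rv iv voo] := v2; split.
- rewrite (_ : (fun x => _) = (fun x => complex.Re (u x) + complex.Re (v x))).
    exact: measurable_funD.
  by apply/funext => x; case: (u x) => p q; case: (v x).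
- rewrite (_ : (fun x => _) = (fun x => complex.Im (u x) + complex.Im (v x))).
    exact: measurable_funD.
  by apply/funext => x; case: (u x) => p q; case: (v x).
- by rewrite (le_lt_trans (L2normD_le u v u2 v2))// lte_add_pinfty.
Qed.

Lemma inL2Z (k : R) u : inL2 u -> inL2 (fun x => k%:C%C * u x).
Proof.
move=> u2; have mn := measurable_normc u u2; have [ru iu uoo] := u2; split.
- rewrite (_ : (fun x => _) = (fun x => k * complex.Re (u x))).
    exact: measurable_funM.
  by apply/funext => x; case: (u x) => p q /=; ring.
- rewrite (_ : (fun x => _) = (fun x => k * complex.Im (u x))).
    exact: measurable_funM.
  by apply/funext => x; case: (u x) => p q /=; ring.
have uL : (@Normc.normc R \o u) \in Lfun mu 2%:E.
  by apply/andP; split; rewrite inE.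
have /andP[_] := Lfun_scale `|k| (ler1n _ 2) uL.
rewrite inE/= /finite_norm; apply: le_lt_trans.
apply: (Lnorm2_mono (@Normc.normc R \o (fun x => k%:C%C * u x))) => x /=.
rewrite Normc.normcM exprMn [leRHS]exprMn mulrC ler_wpM2l ?sqr_ge0//.
by rewrite sqr_normc_ReIm/= expr0n addr0 real_normK ?num_real.
Qed.

Lemma inL2B u v : inL2 u -> inL2 v -> inL2 (fun x => u x - v x).
Proof.
move=> u2 v2; rewrite (_ : (fun x => _) = (fun x => u x + (- 1)%:C%C * v x)).
  by apply: inL2D => //; exact: inL2Z.
apply/funext => x; case: (u x) => p q; case: (v x) => p' q'.
by apply/eqP; rewrite eq_complex/=; apply/andP; split; apply/eqP; ring.
Qed.

Variables (K : set E) (M : R) (phi : E -> R).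
Hypotheses (mK : measurable K) (Kfin : (mu K < +oo)%E) (M0 : 0 <= M).
Hypotheses (mphi : measurable_fun setT phi) (phiM : forall x, `|phi x| <= M).
Hypothesis (phi0 : forall x, ~ K x -> phi x = 0).

(** As phi is real-valued, [pairRe] and [pairIm] are the real and imaginary parts of the L2 pairing
    of u with phi. *)
Definition pairRe u := \int[mu]_x (complex.Re (u x) * phi x).
Definition pairIm u := \int[mu]_x (complex.Im (u x) * phi x).

Lemma integrable_pairRe u : inL2 u ->
  mu.-integrable setT (EFin \o (fun x => complex.Re (u x) * phi x)).
Proof.
move=> /inL2_Re[mu2 u2].
exact: (pairing_integrable _ _ _ mu K M phi mK Kfin M0 mphi phiM phi0 _ mu2 u2).
Qed.

Lemma integrable_pairIm u : inL2 u ->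
  mu.-integrable setT (EFin \o (fun x => complex.Im (u x) * phi x)).
Proof.
move=> /inL2_Im[mu2 u2].
exact: (pairing_integrable _ _ _ mu K M phi mK Kfin M0 mphi phiM phi0 _ mu2 u2).
Qed.

Let C := M * Num.sqrt (fine (mu K)).

Lemma pairRe_le u : inL2 u -> (`|pairRe u|%:E <= C%:E * L2norm u)%E.
Proof.
move=> /inL2_Re[mu2 u2].
apply: le_trans (lee_wpmul2l _ (Lnorm2_Re_le u)).
  exact: (pairing_le _ _ _ mu K M phi mK Kfin M0 mphi phiM phi0 _ mu2 u2).
by rewrite lee_fin mulr_ge0// sqrtr_ge0.
Qed.

Lemma pairRe_sqr_le (D : set E) u : inL2 u -> K `<=` D ->
  ((pairRe u ^+ 2)%:E <= (M ^+ 2 * fine (mu K))%:E *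
     \int[mu]_(x in D) (Normc.normc (u x) ^+ 2)%:E)%E.
Proof.
move=> /inL2_Re[mu2 u2] KD.
apply: le_trans (_ : _ <= (M ^+ 2 * fine (mu K))%:E *
    \int[mu]_(x in K) (complex.Re (u x) ^+ 2)%:E)%E _.
  exact: (pairing_sqr_le _ _ _ mu K M phi mK Kfin M0 mphi phiM phi0 _ mu2 u2).
apply: lee_wpmul2l; first by rewrite lee_fin mulr_ge0 ?sqr_ge0 ?fine_ge0.
apply: ge0_le_integral_mono => // x; rewrite lee_fin ?sqr_ge0//.
by move=> _; rewrite sqr_normc_ReIm lerDl sqr_ge0.
Qed.

Lemma pairIm_sqr_le (D : set E) u : inL2 u -> K `<=` D ->
  ((pairIm u ^+ 2)%:E <= (M ^+ 2 * fine (mu K))%:E *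
     \int[mu]_(x in D) (Normc.normc (u x) ^+ 2)%:E)%E.
Proof.
move=> /inL2_Im[mu2 u2] KD.
apply: le_trans (_ : _ <= (M ^+ 2 * fine (mu K))%:E *
    \int[mu]_(x in K) (complex.Im (u x) ^+ 2)%:E)%E _.
  exact: (pairing_sqr_le _ _ _ mu K M phi mK Kfin M0 mphi phiM phi0 _ mu2 u2).
apply: lee_wpmul2l; first by rewrite lee_fin mulr_ge0 ?sqr_ge0 ?fine_ge0.
apply: ge0_le_integral_mono => // x; rewrite lee_fin ?sqr_ge0//.
by move=> _; rewrite sqr_normc_ReIm lerDr sqr_ge0.
Qed.

Lemma pairReB u v : inL2 u -> inL2 v ->
  pairRe (fun x => u x - v x) = pairRe u - pairRe v.
Proof.
move=> u2 v2; rewrite /pairRe -RintegralB//; try exact: integrable_pairRe.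
by apply: eq_Rintegral => x _; case: (u x) => p q; case: (v x) => p' q' /=; ring.
Qed.

Lemma pairReZ (k : R) u : inL2 u -> pairRe (fun x => k%:C%C * u x) = k * pairRe u.
Proof.
move=> u2; rewrite /pairRe -RintegralZl//; last exact: integrable_pairRe.
by apply: eq_Rintegral => x _; case: (u x) => p q /=; ring.
Qed.

(** By [pairRe_le] the pairing is at most C times the L2 norm; C + 1 replaces C in the denominator
    because C may vanish. *)
Lemma pairRe_cvg (Fl : set_system R) (w : R -> E -> R[i]) : Filter Fl ->
  (\forall s \near Fl, inL2 (w s)) -> L2norm (w s) @[s --> Fl] --> 0%E ->
  pairRe (w s) @[s --> Fl] --> (0 : R).
Proof.
move=> FF w2 w0.
have C0 : 0 <= C by rewrite mulr_ge0// sqrtr_ge0.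
suff h (e : R) : 0 < e -> \forall s \near Fl, `|pairRe (w s)| <= e.
  by apply/cvgr0Pnorm_le => e; exact: h.
move=> e0; have e1 : 0 < e / (C + 1) by rewrite divr_gt0// ltr_wpDl.
have near0 : \forall s \near Fl, (L2norm (w s) < (e / (C + 1))%:E)%E.
  apply: (w0 [set x | (x < (e / (C + 1))%:E)%E]).
  by apply: open_nbhs_nbhs; split; [exact: open_ereal_lt_ereal|rewrite /= lte_fin].
near=> s; have ws : inL2 (w s) by near: s.
rewrite -lee_fin (le_trans (pairRe_le _ ws))//.
apply: (@le_trans _ _ (C%:E * (e / (C + 1))%:E)%E).
  by rewrite lee_wpmul2l ?lee_fin// ltW//; near: s.
rewrite -EFinM lee_fin mulrA ler_pdivrMr ?ltr_wpDl//.
by rewrite mulrC ler_pM2l// lerDl.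
Unshelve. all: by end_near.
Qed.

End L2_pairing.

(** * The equation tested against the bump *)

(** Integrability and the value are proved together, since additivity at each step needs the tail to
    be integrable. *)
Lemma Rintegral_sum {dT} {T : measurableType dT} {R : realType}
    (mu : {measure set T -> \bar R}) {J : Type} (s : seq J) (f : J -> T -> R) :
  (forall j, mu.-integrable setT (EFin \o f j)) ->
  mu.-integrable setT (EFin \o (fun x => \sum_(j <- s) f j x)) /\
  \int[mu]_x (\sum_(j <- s) f j x) = \sum_(j <- s) \int[mu]_x f j x.
Proof.
move=> fi; elim: s => [|j s [si sE]].
  rewrite big_nil; split.
    rewrite (_ : _ \o _ = cst 0%E); first exact: integrable0.
    by apply/funext => x /=; rewrite big_nil.
  under eq_Rintegral do rewrite big_nil.
  by rewrite Rintegral_cst// mul0r.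
split; last first.
  under eq_Rintegral do rewrite big_cons.
  by rewrite RintegralD// big_cons sE.
rewrite (_ : _ \o _ = (EFin \o f j) \+
    (EFin \o (fun x => \sum_(j <- s) f j x)%R))%E.
  exact: integrableD.
by apply/funext => x /=; rewrite big_cons.
Qed.

Section weak_equation.
Context {R : realType} {d : nat}.
Local Notation E := 'rV[R]_d.
Local Notation mu := (@lebesgue_rV R d).
Implicit Types (u v : R -> E -> R[i]) (I : set R).

Section curves.
Variables (K : set E) (M : R) (phi : E -> R).
Hypotheses (mK : measurable K) (Kfin : (mu K < +oo)%E) (M0 : 0 <= M).
Hypotheses (mphi : measurable_fun setT phi) (phiM : forall x, `|phi x| <= M).
Hypothesis (phi0 : forall x, ~ K x -> phi x = 0).

Let pairReB' := pairReB K M phi mK Kfin M0 mphi phiM phi0.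
Let pairReZ' := pairReZ K M phi mK Kfin M0 mphi phiM phi0.
Let pairRe_cvg' := pairRe_cvg K M phi mK Kfin M0 mphi phiM phi0.

(** The difference quotient minus [du] tends to 0 in L2, and the pairing is linear and
    L2-continuous. *)
Lemma pairRe_deriv_on I u du :
  (forall t, I t -> inL2 (u t)) -> (forall t, I t -> inL2 (du t)) ->
  L2_deriv_on I u du ->
  deriv_on I (fun t => pairRe phi (u t)) (fun t => pairRe phi (du t)).
Proof.
move=> u2 du2 udu t It.
pose w s := fun x => ((s - t)^-1)%:C%C * (u s x - u t x) - du t x.
have w2 s : I s -> inL2 (w s).
  by move=> Is; apply: inL2B; [apply/inL2Z/inL2B; exact: u2|exact: du2].
have near_I : \forall s \near within I t^', I s by apply: withinT.
have w0 : pairRe phi (w s) @[s --> within I t^'] --> (0 : R).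
  by apply: pairRe_cvg'; [apply: filterS near_I|exact: udu].
have wD : pairRe phi (w s) + pairRe phi (du t) @[s --> within I t^'] -->
    pairRe phi (du t).
  by rewrite -[X in _ --> X]add0r; apply: cvgD => //; exact: cvg_cst.
apply: cvg_trans wD; apply: near_eq_cvg; near=> s.
have Is : I s by near: s.
rewrite /w pairReB'; [|by apply/inL2Z/inL2B; exact: u2|exact: du2].
rewrite pairReZ'; last by apply: inL2B; exact: u2.
by rewrite pairReB' ?subrK//; exact: u2.
Unshelve. all: by end_near. Qed.

Lemma pairRe_continuous I v : (forall t, I t -> inL2 (v t)) ->
  curve_continuous L2norm I v ->
  {within I, continuous (fun t => pairRe phi (v t))}.
Proof.
move=> v2 vc; apply/subspace_continuousP => t It.
have near_I : \forall s \near within I (nbhs t), I s by apply: withinT.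
have w0 : pairRe phi (fun x => v s x - v t x) @[s --> within I (nbhs t)] --> (0 : R).
  apply: pairRe_cvg'; last exact: vc.
  by apply: filterS near_I => s Is; apply: inL2B; exact: v2.
have wD : pairRe phi (fun x => v s x - v t x) + pairRe phi (v t)
    @[s --> within I (nbhs t)] --> pairRe phi (v t).
  by rewrite -[X in _ --> X]add0r; apply: cvgD => //; exact: cvg_cst.
apply: cvg_trans wD; apply: near_eq_cvg; near=> s.
have Is : I s by near: s.
by rewrite pairReB' ?subrK//; exact: v2.
Unshelve. all: by end_near. Qed.

End curves.

Variable rho : R.
Hypothesis rho0 : 0 <= rho.
Local Notation K := (@cube R d rho (rho + 3)).
Local Notation phi := (@bump R d rho).

Definition bump_laplacian x : R := \sum_i mpartial (dbl i) phi x.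

Lemma bump_test_function : test_function phi.
Proof.
split; first exact/flat_algebra_smooth/flat_algebra_bump.
by exists K; [exact: compact_cube|exact: bump_eq0].
Qed.

Lemma closed_cube : closed K.
Proof.
by apply: compact_closed; [exact: norm_hausdorff|exact: compact_cube].
Qed.

(** Collects what the pairing estimates require of a weight. The next three lemmas do so for the
    other weights built from the bump. *)
Lemma bump_weight b : exists M : R, [/\ 0 <= M,
  measurable_fun setT (mpartial b phi), forall x, `|mpartial b phi x| <= M &
  forall x, ~ K x -> mpartial b phi x = 0].
Proof.
have Ab : flat_algebra (mpartial b phi).
  exact/flat_algebra_mpartial/flat_algebra_bump.
have [M bM] := flat_algebra_bounded _ Ab; exists M; split => //.
- by rewrite (le_trans _ (bM 0)).
- exact: flat_algebra_measurable.
- exact: mpartial_eq0 closed_cube (bump_eq0 rho).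
Qed.

Lemma bump_weight0 : exists M : R, [/\ 0 <= M,
  measurable_fun setT phi, forall x, `|phi x| <= M &
  forall x, ~ K x -> phi x = 0].
Proof.
have Ab := @flat_algebra_bump R d rho.
have [M bM] := flat_algebra_bounded _ Ab; exists M; split => //.
- by rewrite (le_trans _ (bM 0)).
- exact: flat_algebra_measurable.
- exact: bump_eq0.
Qed.

Lemma bump_laplacian_weight : exists M : R, [/\ 0 <= M,
  measurable_fun setT bump_laplacian, forall x, `|bump_laplacian x| <= M &
  forall x, ~ K x -> bump_laplacian x = 0].
Proof.
have /choice[M HM] := fun i => bump_weight (@dbl d i).
exists (\sum_i M i); split.
- by apply: sumr_ge0 => i _; case: (HM i).
- by apply: measurable_sum => i; case: (HM i).
- move=> x; rewrite (le_trans (ler_norm_sum _ _ _))// ler_sum// => i _.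
  by case: (HM i).
- move=> x Kx; rewrite /bump_laplacian big1// => i _; by case: (HM i) => _ _ _; apply.
Qed.

(** On the support of the bump every coordinate lies in [0, rho + 3], which bounds |x|^2 there. *)
Lemma bump_sqnorm_weight : exists M : R, [/\ 0 <= M,
  measurable_fun setT (fun x => sqnorm x * phi x),
  forall x, `|sqnorm x * phi x| <= M &
  forall x, ~ K x -> sqnorm x * phi x = 0].
Proof.
have [M [M0 mphi phiM phi0]] := bump_weight0.
have S0 x : 0 <= @sqnorm R d x by apply: sumr_ge0 => i _; exact: sqr_ge0.
exists (\sum_(i < d) (rho + 3) ^+ 2 * M); split.
- by rewrite sumr_ge0// => i _; rewrite mulr_ge0// sqr_ge0.
- by apply: measurable_funM => //; exact: measurable_sqnorm.
- move=> x; have [Kx|/phi0->] := pselect (K x); last first.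
    by rewrite mulr0 normr0 sumr_ge0// => i _; rewrite mulr_ge0// sqr_ge0.
  rewrite normrM ger0_norm// -mulr_suml ler_pM// /sqnorm ler_sum// => i _.
  have := Kx i; rewrite /= in_itv/= => /andP[x1 x2].
  by rewrite lerXn2r ?nnegrE ?addr_ge0// (le_trans rho0).
- by move=> x /phi0->; rewrite mulr0.
Qed.

Lemma mord_dbl (j : 'I_d) : mord (dbl j) = 2%N.
Proof.
rewrite /mord (bigD1 j)//= ffunE eqxx big1 ?addn0// => i ij.
by rewrite ffunE (negbTE ij).
Qed.

(** The real part of the equation reads Re du = -k1 Im(Delta u) + k2 |x|^2 Im u. The weak second
    derivatives are then transferred to the bump. *)
Lemma pairRe_equation (k1 k2 : R) (u du : E -> R[i]) : inB u -> inL2 du ->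
  {ae mu, forall x, du x + 'i%C * (- k1%:C%C * laplacian u x +
                                   (k2 * sqnorm x)%:C%C * u x) = 0} ->
  pairRe phi du =
  pairIm (fun x => - k1 * bump_laplacian x + k2 * (sqnorm x * phi x)) u.
Proof.
move=> uB du2 eqn; have u2 : inL2 u by case: uB.
have mK := @measurable_cube R d rho (rho + 3).
have Kfin : (mu K < +oo)%E by rewrite lebesgue_cube ?ltry// lerDl.
(* Membership in B, with the zero multi-index as weight, provides a weak derivative, so [wD] is one
   and not the default 0. *)
have wDP j : weak_derivative (dbl j) u (wD (dbl j) u).
  have [|[v vP] _] := uB.2 [ffun=> ord0] (dbl j).
    by rewrite mord_dbl /mord big1// => i _; rewrite ffunE.
  exact: (@xgetPex _ _ [set v | weak_derivative (dbl j) u v] (ex_intro _ v vP)).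
have [M [M0 mphi phiM phi0]] := bump_weight0.
have [M2 [M20 mphi2 phiM2 phi02]] := bump_sqnorm_weight.
have iw j : mu.-integrable setT
    (EFin \o (fun x => complex.Im (wD (dbl j) u x) * phi x)).
  exact: (integrable_pairIm K M phi mK Kfin M0 mphi phiM phi0 _ (wDP j).1).
have ip j : mu.-integrable setT
    (EFin \o (fun x => complex.Im (u x) * mpartial (dbl j) phi x)).
  have [M1 [M10 mphi1 phiM1 phi01]] := bump_weight (dbl j).
  exact: (integrable_pairIm K M1 _ mK Kfin M10 mphi1 phiM1 phi01 _ u2).
have is2 : mu.-integrable setT
    (EFin \o (fun x => complex.Im (u x) * (sqnorm x * phi x))).
  exact: (integrable_pairIm K M2 _ mK Kfin M20 mphi2 phiM2 phi02 _ u2).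
(* The sign is (-1)^2 = 1 because [dbl j] has order 2. *)
have weak j : \int[mu]_x (complex.Im (wD (dbl j) u x) * phi x) =
    \int[mu]_x (complex.Im (u x) * mpartial (dbl j) phi x).
  have := congr1 (@complex.Im R) ((wDP j).2 phi bump_test_function).
  rewrite mord_dbl sqrrN expr1n mul1r /cintegral /= => imE.
  transitivity (\int[mu]_x complex.Im (wD (dbl j) u x * (phi x)%:C%C)).
    by apply: eq_Rintegral => x _; case: (wD _ _ x) => p q /=; ring.
  by rewrite -imE; apply: eq_Rintegral => x _; case: (u x) => p q /=; ring.
have [iw' sw] := Rintegral_sum mu (index_enum 'I_d) _ iw.
have [ip' sp] := Rintegral_sum mu (index_enum 'I_d) _ ip.
have iZ (k : R) f : mu.-integrable setT (EFin \o f) ->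
    mu.-integrable setT (EFin \o (fun x => k * f x)).
  by move=> fi; apply: (integrableZl measurableT k fi).
transitivity (\int[mu]_x (- k1 * (\sum_j complex.Im (wD (dbl j) u x) * phi x) +
                          k2 * (complex.Im (u x) * (sqnorm x * phi x)))).
  rewrite /pairRe /Rintegral; congr fine; apply: ae_eq_integral => //.
  - exact: measurable_int (integrable_pairRe K M phi mK Kfin M0 mphi phiM phi0 _ du2).
  - apply/measurable_EFinP/measurable_funD.
      by apply/measurable_EFinP; exact: measurable_int (iZ _ _ iw').
    by apply/measurable_EFinP; exact: measurable_int (iZ _ _ is2).
  - apply: filterS eqn => x eqx _; congr EFin.
    rewrite -mulr_suml; have := congr1 (@complex.Re R) eqx.
    have <- : complex.Im (laplacian u x) = \sum_j complex.Im (wD (dbl j) u x).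
      rewrite /laplacian; apply: (big_morph (@complex.Im R)) => //.
      by move=> [p q] [p' q'].
    case: (du x) => p q; case: (laplacian u x) => p' q'; case: (u x) => p2 q2 /= e.
    have -> : p = - k1 * q' + k2 * sqnorm x * q2 by lra.
    by ring.
rewrite RintegralD ?RintegralZl//; try exact: iZ.
rewrite sw (eq_bigr _ (fun j _ => weak j)) -sp.
rewrite -!RintegralZl// -RintegralD//; try exact: iZ.
apply: eq_Rintegral => x _; rewrite /bump_laplacian mulrDr; congr (_ + _).
  by rewrite -mulr_sumr mulrCA.
by rewrite mulrCA.
Qed.

End weak_equation.

(** * Bounding the initial pairing by the space-time norm *)

Section observability.
Context {R : realType} {d : nat}.
Local Notation E := 'rV[R]_d.
Local Notation mu := (@lebesgue_rV R d).

(** The order of quantifiers matters: A is fixed from the bounds a1 and a2 before the coefficients,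
    the region and the solution are given. *)
Lemma bump_observable (rho T a1 a2 : R) : 0 <= rho -> 0 < T ->
  exists2 A : R, 0 < A & forall (D : set E) (k1 k2 : R -> R) u0 u,
    cube rho (rho + 3) `<=` D ->
    (forall t, 0 < t < T -> `|k1 t| <= a1) ->
    (forall t, 0 < t < T -> `|k2 t| <= a2) ->
    inL2 u0 -> B_solution T k1 k2 u0 u ->
    (`|pairRe (@bump R d rho) u0|%:E <= A%:E * spacetime_norm T D u)%E.
Proof.
move=> rho0 T0; set K := cube rho (rho + 3); set phi := @bump R d rho.
have mK : measurable K := measurable_cube _ _.
have Kfin : (mu K < +oo)%E by rewrite lebesgue_cube ?ltry// lerDl.
have [M [M0 mphi phiM phi0]] := @bump_weight0 R d rho.
have [M1 [M10 mphi1 phiM1 phi01]] := @bump_laplacian_weight R d rho.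
have [M2 [M20 mphi2 phiM2 phi02]] := @bump_sqnorm_weight R d rho rho0.
(* [Mz] bounds the weight paired with Im u in the formula for F'. Absolute values keep it
   nonnegative for arbitrary a1 and a2. *)
pose Mz : R := `|a1| * M1 + `|a2| * M2.
have Mz0 : 0 <= Mz by rewrite addr_ge0// mulr_ge0.
(* One constant serves both F and F'; the summand 1 makes it positive. *)
pose B := (M + Mz + 1) ^+ 2 * fine (mu K).
have B0 : 0 < B.
  rewrite mulr_gt0 ?exprn_gt0//; first by rewrite ltr_wpDl// addr_ge0.
  by rewrite lebesgue_cube/= ?lerDl// exprn_gt0// addrAC subrr add0r.
(* Solves T F(0)^2 <= B (1 + 2T) J for |F(0)|, where J is the squared space-time norm. *)
pose A : R := Num.sqrt (B * (1 + 2 * T) / T).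
have BT0 : 0 < B * (1 + 2 * T) / T.
  by rewrite divr_gt0// mulr_gt0// ltr_wpDr// mulr_ge0// ltW.
exists A; first by rewrite sqrtr_gt0.
move=> D k1 k2 u0 u KD k1a k2a u02 [uB _ u0E [du [du2 duc udu eqn]]].
have u2 t : `[0, T]%classic t -> inL2 (u t) by move=> /uB[].
have It t : 0 < t < T -> `[0, T]%classic t.
  by move=> /andP[t0 tT]; rewrite /= in_itv/= !ltW.
pose H t := (\int[mu]_(x in D) (Normc.normc (u t x) ^+ 2)%:E)%E.
have H0 t : (0 <= H t)%E by apply: integral_ge0 => x _; rewrite lee_fin sqr_ge0.
have bound c t : 0 <= c -> c <= M + Mz + 1 ->
    ((c ^+ 2 * fine (mu K))%:E * H t <= B%:E * H t)%E.
  move=> c0 cM; apply: lee_wpmul2r => //; rewrite lee_fin ler_wpM2r ?fine_ge0//.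
  by rewrite lerXn2r ?nnegrE// (le_trans c0).
have FH t : 0 < t < T -> ((pairRe phi (u t) ^+ 2)%:E <= B%:E * H t)%E.
  move=> tT; apply: le_trans (bound M t M0 _); last by rewrite -addrA lerDl addr_ge0.
  exact: (pairRe_sqr_le K M phi mK Kfin M0 mphi phiM phi0 D _ (u2 t (It t tT)) KD).
have DH t : 0 < t < T -> ((pairRe phi (du t) ^+ 2)%:E <= B%:E * H t)%E.
  move=> tT; have tT' : 0 < t <= T by case/andP: tT => -> /ltW ->.
  rewrite (pairRe_equation rho rho0 (k1 t) (k2 t) (u t))//.
  - apply: le_trans (bound Mz t Mz0 _); last by rewrite addrAC lerDr addr_ge0.
    pose zeta x := - k1 t * bump_laplacian rho x + k2 t * (sqnorm x * phi x).
    apply: (pairIm_sqr_le K Mz zeta) => //.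
    + by apply: measurable_funD; apply: measurable_funM.
    + move=> x; rewrite /zeta (le_trans (ler_normD _ _))//.
      rewrite [X in X + _]normrM [X in _ + X]normrM normrN.
      have k1b := le_trans (k1a t tT) (ler_norm a1).
      have k2b := le_trans (k2a t tT) (ler_norm a2).
      by apply: lerD; apply: ler_pM.
    + by move=> x Kx; rewrite /zeta phi01// phi02// !mulr0 addr0.
    + exact: u2 (It t tT).
  - exact: uB (It t tT).
  - exact: du2 (It t tT).
  - exact: eqn.
(* The initial condition holds only almost everywhere, which suffices for the pairing. *)
have F0E : pairRe phi (u 0) = pairRe phi u0.
  have u2_0 : inL2 (u 0) by apply: u2; rewrite /= in_itv/= lexx ltW.
  rewrite /pairRe /Rintegral; congr fine; apply: ae_eq_integral => //.
  - exact: measurable_int (integrable_pairRe K M phi mK Kfin M0 mphi phiM phi0 _ u2_0).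
  - exact: measurable_int (integrable_pairRe K M phi mK Kfin M0 mphi phiM phi0 _ u02).
  - by apply: filterS u0E => x u0x _; rewrite u0x.
have dF := pairRe_deriv_on K M phi mK Kfin M0 mphi phiM phi0 _ _ _ u2 du2 udu.
have cD := pairRe_continuous K M phi mK Kfin M0 mphi phiM phi0 _ _ du2 duc.
have := sqr_initial_le T B _ _ H T0 B0 dF cD H0 FH DH.
rewrite F0E /spacetime_norm -/(H _) => main.
set J := (\int[_]_(t in _) _)%E in main *.
have J0 : (0 <= J)%E by apply: integral_ge0.
case: J J0 main => [j| |]//; last first.
  by move=> _ _; rewrite poweRyr ?invr_neq0// gt0_muley ?leey ?lte_fin ?sqrtr_gt0.
rewrite lee_fin => j0; rewrite poweR12_EFin// -!EFinM !lee_fin => main.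
rewrite -sqrtr_sqr /A -sqrtrM; last exact: ltW.
by rewrite ler_wsqrtr// mulrAC ler_pdivlMr// mulrC.
Qed.

End observability.

(** * Norm of the Gaussian sum and its pairing with the bump *)

Section gaussian_bounds.
Context {R : realType} {d : nat}.
Local Notation E := 'rV[R]_d.
Local Notation mu := (@lebesgue_rV R d).
Variables (N : nat) (eps : R) (a : {ffun 'I_d -> 'I_N.+1} -> E)
  (c : {ffun 'I_d -> 'I_N.+1} -> R).
Hypotheses (eps0 : 0 < eps) (epsN : eps * N%:R <= 1).
Hypothesis aE : forall n, multi_le n -> a n = eps *: mvec n.
Hypothesis c0 : forall n, multi_le n -> 0 <= c n.
Local Notation mass := (\sum_(n | multi_le n) c n).
Local Notation G := (fun x => (gaussian_sum a c x)%:C%C).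

Let mass0 : 0 <= mass. Proof. exact: sumr_ge0. Qed.

(** The pointwise bound has rate 1/2, so its square is a multiple of exp(-|x|^2), whose integral is
    sqrt(pi)^d. *)
Lemma L2norm_gaussian_sum_le :
  (L2norm G <= (mass * (expR d%:R * Num.sqrt (Num.sqrt pi ^+ d)))%:E)%E.
Proof.
pose b := mass * expR d%:R; have b0 : 0 <= b by rewrite mulr_ge0// expR_ge0.
pose h (x : E) := b * expR (- (2^-1 * sqnorm x)).
apply: (@le_trans _ _ (Lnorm mu 2%:E (EFin \o h))).
  apply: (Lnorm2_mono (@Normc.normc R \o G)) => x.
  rewrite /= expr0n/= addr0 sqr_sqrtr ?sqr_ge0// lerXn2r ?nnegrE//.
  - exact: gaussian_sum_ge0.
  - by rewrite mulr_ge0// expR_ge0.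
  - exact: (gaussian_sum_le N eps).
rewrite Lnorm2E (_ : (\int[mu]_x _)%E = (b ^+ 2 * Num.sqrt pi ^+ d)%:E).
  by rewrite poweR12_EFin ?mulr_ge0 ?sqr_ge0// sqrtrM ?sqr_ge0//
    sqrtr_sqr ger0_norm// mulrA.
rewrite EFinM -lebesgue_rV_gauss -ge0_integralZl_EFin ?sqr_ge0//.
  apply: eq_integral => x _; rewrite -EFinM /h exprMn; congr (_ * _)%:E.
  by rewrite expr2 -expRD; congr expR; lra.
apply/measurable_EFinP; apply: measurableT_comp => //.
by apply: measurableT_comp => //; exact: measurable_sqnorm.
Qed.

Lemma inL2_gaussian_sum : inL2 G.
Proof.
split; first exact: measurable_gaussian_sum.
  by rewrite (_ : (fun x => _) = cst 0); [exact: measurable_cst|exact/funext].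
by rewrite (le_lt_trans L2norm_gaussian_sum_le)// ltry.
Qed.

(** The integrand is nonnegative, and on the middle cube, of volume 1, both the Gaussian sum and the
    bump are bounded below. *)
Lemma pairRe_gaussian_sum_ge (rho : R) : 0 <= rho ->
  mass * (expR (- ((rho + 3) ^+ 2 * d%:R)) * expR (- 2) ^+ d) <=
  pairRe (bump rho) G.
Proof.
move=> rho0; set kap := _ * _ ^+ d.
have [M [M0 mphi phiM phi0]] := @bump_weight0 R d rho.
have ig := integrable_pairRe _ M _ (measurable_cube rho (rho + 3)) _ M0 mphi
  phiM phi0 _ inL2_gaussian_sum.
rewrite -lee_fin /pairRe /Rintegral fineK; last first.
  apply: integrable_fin_num => //; apply: ig.
  by rewrite lebesgue_cube ?ltry// lerDl.
have -> : (mass * kap)%:E = ((mass * kap)%:E * mu (cube (rho + 1) (rho + 2)))%E.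
  rewrite lebesgue_cube; last by lra.
  by rewrite (_ : _ - _ = 1) ?expr1n ?mule1//; ring.
rewrite -integral_cst; last exact: measurable_cube.
have kap0 : 0 <= kap by rewrite mulr_ge0 ?exprn_ge0 ?expR_ge0.
apply: ge0_le_integral_mono => // [x|x|x xc] /=; rewrite lee_fin.
- by rewrite mulr_ge0.
- by rewrite mulr_ge0 ?bump_ge0//; exact: gaussian_sum_ge0.
- rewrite /kap mulrA ler_pM ?exprn_ge0 ?mulr_ge0 ?expR_ge0//.
    exact: (gaussian_sum_ge N eps).
  exact: bump_ge.
Qed.

End gaussian_bounds.

(** * Choice of the constant and conclusion *)

Theorem theorem3 (R : realType) (d : nat) (Omega : set 'rV[R]_d)
    (T m1 m2 : R) :
  (0 < d)%N -> bounded_domain Omega -> centered_at_origin Omega -> 0 < T ->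
  exists2 CT : R, CT != 0 &
  forall (k1 dk1 k2 : R -> R) (TD : \bar R),
    coefficients k1 dk1 k2 ->
    flow_nonzero d [set t | 0 <= t /\ (t%:E <= TD)%E] k1 k2 ->
    (T%:E < TD)%E ->
    supnorm T k1 + supnorm T dk1 = m1 ->
    supnorm T k2 = m2 ->
  forall y1 y2 y3 : R -> R,
    riccati_system `[0, T] k1 k2 y1 y2 y3 ->
  forall (u0 : 'rV[R]_d -> R[i]) (N : nat) (eta : R)
      (a : {ffun 'I_d -> 'I_N.+1} -> 'rV[R]_d)
      (c : {ffun 'I_d -> 'I_N.+1} -> R),
    class_A u0 eta a c ->
  forall eps R0 : R,
    0 < eps ->
    (forall n, multi_le n -> a n = eps *: mvec n) ->
    1 < R0 ->
    Omega `<=` eball R0 ->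
    (forall t, 0 <= t <= T -> eps_small N eps R0 (y2 t) (y3 t)) ->
  forall u : R -> 'rV[R]_d -> R[i],
    B_solution T k1 k2 u0 u ->
    (L2norm u0 - eta%:E
       <= CT%:E * (spacetime_norm T (~` closure Omega) u + (T * eta)%:E))%E.
Proof.
move=> d0 _ [r r0 Or] T0.
(* The cube is placed with the radius r of [centered_at_origin], so that the constant is fixed
   before [R0] is introduced. *)
pose rho : R := r + 1; have rho0 : 0 <= rho by rewrite addr_ge0// ltW.
have [A A0 obs] := bump_observable (d := d) rho T m1 m2 rho0 T0.
have [M [M0 mphi phiM phi0]] := @bump_weight0 R d rho.
have mK := @measurable_cube R d rho (rho + 3).
have Kfin : (lebesgue_rV d (cube rho (rho + 3)) < +oo)%E.
  by rewrite lebesgue_cube ?ltry// lerDl.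
pose C : R := M * Num.sqrt (fine (lebesgue_rV d (cube rho (rho + 3)))).
pose Gc : R := expR d%:R * Num.sqrt (Num.sqrt pi ^+ d).
pose kap : R := expR (- ((rho + 3) ^+ 2 * d%:R)) * expR (- 2) ^+ d.
have C0 : 0 <= C by rewrite mulr_ge0// sqrtr_ge0.
have kap0 : 0 < kap by rewrite mulr_gt0 ?exprn_gt0 ?expR_gt0.
have Gc0 : 0 <= Gc by rewrite mulr_ge0 ?expR_ge0 ?sqrtr_ge0.
(* Q is the ratio between the upper bound for the norm of g and the lower bound for its pairing with
   the bump. *)
pose Q := Gc / kap; have Q0 : 0 <= Q by rewrite divr_ge0// ltW.
(* The first term absorbs the space-time norm, the second absorbs the error Q C eta through T eta,
   and 1 ensures that [CT] is nonzero. *)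
pose CT := Q * A + Q * C / T + 1.
have QA0 : 0 <= Q * A by exact: (mulr_ge0 Q0 (ltW A0)).
have QC0 : 0 <= Q * C / T by exact: (divr_ge0 (mulr_ge0 Q0 C0) (ltW T0)).
have CT0 : 0 < CT by rewrite ltr_wpDl// addr_ge0.
exists CT; first by rewrite gt_eqF.
move=> k1 dk1 k2 TD [k1d _ _ k2c _] _ _ m1E m2E y1 y2 y3 [_ _ _ [_ y20 y30]].
move=> u0 N eta a c [u0B N2 /andP[eta0 _] c0 u0g] eps R0 eps0 aE R01 _ small.
move=> u solu.
have T0' : 0 <= T := ltW T0.
have epsN : eps * N%:R <= 1.
  have := small 0; rewrite lexx T0' y20 y30 => /(_ isT); apply: eps_small_le1 => //.
    exact: leq_trans N2.
  exact: lt_trans R01.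
have sub0 : `[0, T] `<=` `[0, +oo[%classic.
  by move=> t /=; rewrite !in_itv/= => /andP[->].
have k1m t : 0 < t < T -> `|k1 t| <= m1.
  move=> /andP[t0 tT]; have tI : 0 <= t <= T by rewrite !ltW.
  have ck1 : {within `[0, T], continuous k1}.
    exact: continuous_subspaceW sub0 (deriv_on_within_continuous _ _ _ k1d).
  by rewrite -m1E (le_trans (le_supnorm T k1 t ck1 tI))// lerDl supnorm_ge0.
have k2m t : 0 < t < T -> `|k2 t| <= m2.
  move=> /andP[t0 tT]; have tI : 0 <= t <= T by rewrite !ltW.
  by rewrite -m2E; exact: le_supnorm T k2 t (continuous_subspaceW sub0 k2c) tI.
have u02 : inL2 u0 by case: u0B.
have KD := cube_disjoint_closure Omega r (rho + 3) d0 Or.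
have := obs _ k1 k2 u0 u KD k1m k2m u02 solu.
set g := (fun x => (gaussian_sum a c x)%:C%C) in u0g.
set mass := \sum_(n | multi_le n) c n.
have g2 : inL2 g by exact: (inL2_gaussian_sum N eps a c).
have gle : (L2norm g <= (mass * Gc)%:E)%E by exact: (L2norm_gaussian_sum_le N eps).
have gge : mass * kap <= pairRe (bump rho) g.
  exact: (pairRe_gaussian_sum_ge N eps).
have dif2 := inL2B _ _ u02 g2.
(* C bounds the norm of the pairing functional, and u0 is within eta of g in L2. *)
have dif : `|pairRe (bump rho) u0 - pairRe (bump rho) g| <= C * eta.
  rewrite -(pairReB _ M _ mK Kfin M0 mphi phiM phi0)// -lee_fin EFinM.
  apply: le_trans (pairRe_le _ M _ mK Kfin M0 mphi phiM phi0 _ dif2) _.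
  by rewrite lee_wpmul2l ?lee_fin.
have u0le : (L2norm u0 <= eta%:E + (mass * Gc)%:E)%E.
  rewrite (_ : u0 = fun x => (u0 x - g x) + g x); last first.
    by apply/funext => x; rewrite subrK.
  by apply: le_trans (L2normD_le _ _ dif2 g2) _; exact: leeD.
have S0 : (0 <= spacetime_norm T (~` closure Omega) u)%E by exact: poweR_ge0.
case: (spacetime_norm _ _ _) S0 => [S| |]//; last first.
  by move=> _ _; rewrite addye// gt0_muley ?leey ?lte_fin.
rewrite lee_fin => S0; rewrite -!EFinM lee_fin => F0.
apply: (@le_trans _ _ (mass * Gc)%:E).
  by rewrite leeBlDl.
rewrite lee_fin.
(* The pairing with g exceeds the pairing with u0 by at most C eta, and the latter is at most A
   S. *)
have massle : mass * kap <= A * S + C * eta.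
  apply: le_trans gge _.
  have := ler_norm (pairRe (bump rho) u0).
  have := ler_norm (- (pairRe (bump rho) u0 - pairRe (bump rho) g)).
  rewrite normrN; lra.
have -> : mass * Gc = mass * kap * Q by rewrite /Q; field; rewrite gt_eqF.
apply: le_trans (ler_wpM2r Q0 massle) _.
(* The terms in S and in eta are compared separately. *)
rewrite mulrDr mulrDl lerD//.
  by rewrite mulrAC ler_wpM2r// mulrC /CT -addrA lerDl addr_ge0.
rewrite [leRHS]mulrA [leLHS]mulrAC ler_wpM2r ?(ltW eta0)//.
have -> : CT * T = Q * A * T + (C * Q + T) by rewrite /CT; field; rewrite gt_eqF.
by rewrite ler_wpDl ?lerDl// mulr_ge0.
Qed.
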